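(* Let $A$ be a commutative ring, let $m,n\geq 1$, and let $\phi:\mathcal L^n(A)\to\mathcal L^m(A)$ be a continuous homomorphism of $A$-algebras. Suppose that the image of $d(\phi)$ under the natural homomorphism $\underline{\mathbb Z}(A)\to A$ is not a zero divisor in the ring $A$. Then $\phi$ is injective.
   Context: Rings are commutative, associative and unital. For $n\geq 1$, $\mathcal L^n(A)=A((t_1))\ldots((t_n))$ is the ring of iterated Laurent series (inductively $\mathcal L^1(A)=A((t_1))$, $\mathcal L^n(A)=\mathcal L^{n-1}(A)((t_n))$). Elements are written $f=\sum_{l\in\mathbb Z^n}a_lt^l$ with $t^l=t_1^{l_1}\cdots t_n^{l_n}$, and $\mathrm{supp}(f)=\{l: a_l\neq 0\}$. Put $\Lambda_1=\mathbb Z$, $\mathbb Z^1_\lambda=\{l\in\mathbb Z: l\geq\lambda\}$, and for $n\geq 2$ put $\Lambda_n=\mathrm{Map}(\mathbb Z,\Lambda_{n-1})\times\mathbb Z$ and $\mathbb Z^n_\lambda=\bigcup_{l_n\geq\lambda_n}\mathbb Z^{n-1}_{\lambda'(l_n)}\times\{l_n\}$ for $\lambda=(\lambda',\lambda_n)\in\Lambda_n$. A formal series lies in $\mathcal L^n(A)$ iff its support is contained in $\mathbb Z^n_\lambda$ for some $\lambda\in\Lambda_n$. Topology: $\mathcal L^n(A)$ is an additive topological group with a base of open neighborhoods of zero given by the $A$-submodules $U_\lambda=\{f:\mathrm{supp}(f)\cap(-\mathbb Z^n_\lambda)=\varnothing\}$, $\lambda\in\Lambda_n$. $\underline{\mathbb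 Z}(A)$ is the ring of locally constant functions $\mathrm{Spec}(A)\to\mathbb Z$; the natural homomorphism $\underline{\mathbb Z}(A)\to A$ sends a function with values $c_i$ on the factors of a finite decomposition $A\simeq\prod_iA_i$ to $(c_i\cdot 1)_i$. The lexicographical order on $\mathbb Z^n$ compares the last coordinates first: $(l_1,\ldots,l_n)\leq(l_1',\ldots,l_n')$ iff $l_n<l'_n$, or $l_n=l_n'$ and $(l_1,\ldots,l_{n-1})\leq(l'_1,\ldots,l'_{n-1})$. For $f\in\mathcal L^n(A)^*$ it is known that there is a finite decomposition $A\simeq\prod_i A_i$ and elements $l_i\in\mathbb Z^n$ such that the component $\sum_l a_{i,l}t^l\in\mathcal L^n(A_i)$ of $f$ has $a_{i,l}$ nilpotent for all $l<l_i$ and $a_{i,l_i}$ invertible; then $\nu(f)\in\underline{\mathbb Z}(A)^n$ is the locally constant function with value $l_i$ on $\mathrm{Spec}(A_i)$, and $\nu:\mathcal L^n(A)^*\to\underline{\mathbb Z}(A)^n$ is a group homomorphism. Elements of $\underline{\mathbb Z}(A)^n$ are viewed as columns. For a continuous $A$-algebra homomorphism $\phi:\mathcal L^n(A)\to\mathcal L^m(A)$, $\Upsilon(\phi)$ is the $(m\times n)$-matrix $(x_{ji})$ over $\underline{\mathbb Z}(A)$ with columns $\nu(\phi(t_1)),\ldots,\nu(\phi(t_n))$. It is known that, at every point of $\mathrm{Spec}(A)$, this matrix is in column echelon form with positive leading entries: there are $1\leq p_1<\ldots<p_n\leq m$ in $\underline{\mathbb Z}(A)$ with $x_{p_i,i}>0$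 and $x_{j,i}=0$ for $j>p_i$ (pointwise on $\mathrm{Spec}(A)$). Put $d(\phi)=\prod_{i=1}^n x_{p_i,i}\in\underline{\mathbb Z}(A)$. *)

(* Defs.v *)
From HB Require Import structures.
From mathcomp Require Import all_boot all_order all_algebra.
From mathcomp Require Import zify.
From mathcomp Require Import all_classical all_analysis.

Set Implicit Arguments.
Unset Strict Implicit.
Unset Printing Implicit Defensive.

Import Order.TTheory GRing.Theory Num.Theory.
Local Open Scope classical_set_scope.
Local Open Scope ring_scope.

(* All rings are [comPzRingType]s, so that the zero ring is allowed. *)
Section LaurentSeries.
Variable R : comPzRingType.
Implicit Types f g h : int -> R.

Definition bounded_below f := exists N : int, forall i : int, i < N -> f i = 0.

Definition laurent_pred : {pred int -> R} := fun f => `[< bounded_below f >].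

Lemma laurent_predP f : reflect (bounded_below f) (f \in laurent_pred).
Proof. exact: asboolP. Qed.

Lemma laurent_zmod_closed : zmod_closed laurent_pred.
Proof.
split=> [|f g /laurent_predP[N fN] /laurent_predP[M gM]].
  by apply/laurent_predP; exists 0.
apply/laurent_predP; exists (Num.min N M) => i; rewrite lt_min => /andP[iN iM].
by rewrite addrfctE opprfctE fN// gM// subr0.
Qed.

HB.instance Definition _ :=
  GRing.isZmodClosed.Build (int -> R) laurent_pred laurent_zmod_closed.

Record laurent :=
  Laurent { lcoef :> int -> R; lcoefP : lcoef \in laurent_pred }.

HB.instance Definition _ := [isSub for lcoef].
HB.instance Definition _ := [Choice of laurent by <:].
HB.instance Definition _ := [SubChoice_isSubZmodule of laurent by <:].

(* The sum has finitely many nonzero terms when f and g are bounded below. *)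
Definition cauchy_prod f g (k : int) : R :=
  \sum_(i \in [set: int]) f i * g (k - i).

Lemma cauchy_prodE f g (N M k : int) (d : nat) :
  (forall i : int, i < N -> f i = 0) -> (forall i : int, i < M -> g i = 0) ->
  k - N - M < d%:Z ->
  cauchy_prod f g k = \sum_(j < d) f (N + j%:Z) * g (k - (N + j%:Z)).
Proof.
move=> fN gM kd.
rewrite /cauchy_prod (@fsbigE _ _ _ _ _ [seq N + j%:Z | j <- iota 0 d])//.
- rewrite -(big_mkord xpredT (fun j => f (N + j%:Z) * g (k - (N + j%:Z)))).
  by rewrite big_map /index_iota subn0; apply: eq_bigl => i; rewrite in_setT.
- apply: etrans (map_inj_uniq _ _) (iota_uniq 0 d).
  by move=> i j /addrI [].
- move=> i _ ni; have [iN|Ni] := ltP i N; first by rewrite fN ?mul0r.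
  have [kiM|Mki] := ltP (k - i) M; first by rewrite gM ?mulr0.
  exfalso; move/negP: ni; apply; apply/mapP; exists `|i - N|%N; last by lia.
  by rewrite mem_iota; lia.
Qed.

Lemma cauchy_prod_bounded f g (N M : int) :
  (forall i : int, i < N -> f i = 0) -> (forall i : int, i < M -> g i = 0) ->
  forall k, k < N + M -> cauchy_prod f g k = 0.
Proof.
by move=> fN gM k kNM; rewrite (@cauchy_prodE _ _ N M _ 0)// ?big_ord0//; lia.
Qed.

Lemma cauchy_prodA f g h :
  bounded_below f -> bounded_below g -> bounded_below h ->
  cauchy_prod f (cauchy_prod g h) = cauchy_prod (cauchy_prod f g) h.
Proof.
move=> [N fN] [M gM] [P hP]; apply/funext => k.
pose d := `|(k - N - M - P + 1)%R|%N.
have kd : k - N - M - P < d%:Z by rewrite /d; lia.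
rewrite (@cauchy_prodE _ _ N (M + P) _ d)//; last 2 first.
- exact: cauchy_prod_bounded.
- by lia.
rewrite (@cauchy_prodE _ _ (N + M) P _ d)//; last 2 first.
- exact: cauchy_prod_bounded.
- by lia.
under eq_bigr => i _.
  rewrite (@cauchy_prodE _ _ (M - i%:Z) P _ d)//; last 2 first.
  - by move=> j jM; apply: gM; lia.
  - by lia.
  rewrite mulr_sumr.
  over.
rewrite exchange_big /=; apply: eq_bigr => j _.
rewrite (@cauchy_prodE _ _ N M _ d)//; last by have := ltn_ord j; lia.
rewrite mulr_suml; apply: eq_bigr => i _; rewrite mulrA.
by congr (_ * g _ * h _); lia.
Qed.

Lemma cauchy_prodC f g : cauchy_prod f g = cauchy_prod g f.
Proof.
apply/funext => k; rewrite /cauchy_prod.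
rewrite (@reindex_fsbigT _ _ _ _ _ (fun i => k - i)); last first.
  by exists (fun i => k - i) => i; lia.
by apply: eq_fsbigr => i _; rewrite mulrC; congr (g _ * _); lia.
Qed.

Lemma cauchy_prodDl f g h :
  bounded_below f -> bounded_below g -> bounded_below h ->
  cauchy_prod (f + g) h = cauchy_prod f h + cauchy_prod g h.
Proof.
move=> [N fN] [M gM] [P hP]; apply/funext => k.
rewrite -[RHS]/(cauchy_prod f h k + cauchy_prod g h k).
pose Q := Num.min N M; pose d := `|(k - Q - P + 1)%R|%N.
have fQ i : i < Q -> f i = 0 by move=> iQ; apply: fN; lia.
have gQ i : i < Q -> g i = 0 by move=> iQ; apply: gM; lia.
have kd : k - Q - P < d%:Z by rewrite /d; lia.
have fgQ i : i < Q -> (f + g) i = 0.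
  by move=> iQ; rewrite addrfctE fQ// gQ// addr0.
rewrite (cauchy_prodE fgQ hP kd) (cauchy_prodE fQ hP kd) (cauchy_prodE gQ hP kd).
by rewrite -big_split; apply: eq_bigr => i _; rewrite addrfctE mulrDl.
Qed.

Definition const_fun (a : R) : int -> R := fun i => if i == 0 then a else 0.

Lemma const_fun_bounded a i : i < 0 -> const_fun a i = 0.
Proof. by rewrite /const_fun => /lt_eqF ->. Qed.

Lemma cauchy_prod_const a f : bounded_below f ->
  cauchy_prod (const_fun a) f = (fun k => a * f k).
Proof.
move=> [N fN]; apply/funext => k; pose d := `|(k - N + 1)%R|%N.
rewrite (@cauchy_prodE _ _ 0 N _ d.+1)//; last by rewrite /d; lia.
  rewrite big_ord_recl /= big1 ?addr0 /const_fun ?eqxx ?subr0// => i _.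
  by rewrite add0r /= mul0r.
exact: const_fun_bounded.
Qed.

Definition monomial_fun (n : int) : int -> R :=
  fun i => if i == n then 1 else 0.

Lemma const_funP a : const_fun a \in laurent_pred.
Proof. by apply/laurent_predP; exists 0 => i; apply: const_fun_bounded. Qed.

Lemma monomial_funP n : monomial_fun n \in laurent_pred.
Proof.
by apply/laurent_predP; exists n => i; rewrite /monomial_fun => /lt_eqF ->.
Qed.

Lemma cauchy_prodP f g : f \in laurent_pred -> g \in laurent_pred ->
  cauchy_prod f g \in laurent_pred.
Proof.
move=> /laurent_predP[N fN] /laurent_predP[M gM]; apply/laurent_predP.
by exists (N + M); apply: cauchy_prod_bounded.
Qed.

Definition laurentC (a : R) : laurent := Laurent (const_funP a).
Definition laurentX : laurent := Laurent (monomial_funP 1).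
Definition laurent_mul (u v : laurent) : laurent :=
  Laurent (cauchy_prodP (lcoefP u) (lcoefP v)).

Lemma laurentP (u v : laurent) : lcoef u = lcoef v -> u = v.
Proof. exact: val_inj. Qed.

Let bndP (u : laurent) : bounded_below u.
Proof. exact/laurent_predP/lcoefP. Qed.

Fact laurent_mulA : associative laurent_mul.
Proof. by move=> u v w; apply/laurentP/cauchy_prodA. Qed.

Fact laurent_mulC : commutative laurent_mul.
Proof. by move=> u v; apply/laurentP/cauchy_prodC. Qed.

Fact laurent_mul1r : left_id (laurentC 1) laurent_mul.
Proof.
move=> u; apply/laurentP; rewrite /= cauchy_prod_const//.
by apply/funext => k; rewrite mul1r.
Qed.

Fact laurent_mulDl : left_distributive laurent_mul +%R.
Proof. by move=> u v w; apply/laurentP/cauchy_prodDl. Qed.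

HB.instance Definition _ := GRing.Zmodule_isComPzRing.Build laurent
  laurent_mulA laurent_mulC laurent_mul1r laurent_mulDl.

End LaurentSeries.

Arguments laurentX {R}.

(* [iter_laurent A n] is A((t_1))...((t_n)). The outermost variable is the last
   one, which has index [ord_max]; the index i in 'I_n stands for t_(i+1). *)
Fixpoint iter_laurent (A : comPzRingType) (n : nat) : comPzRingType :=
  if n is n'.+1 then laurent (iter_laurent A n') else A.

Definition ilaurent (A : comPzRingType) (n : nat) : Type := iter_laurent A n.
HB.instance Definition _ A n := GRing.ComPzRing.on (ilaurent A n).

(* The structure map of the A-algebra L^n(A); a homomorphism of A-algebras is a
   ring morphism commuting with it ([algType] would exclude the zero ring). *)
Fixpoint ilaurentC (A : comPzRingType) (n : nat) : A -> ilaurent A n :=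
  if n is n'.+1 then fun a => laurentC (ilaurentC n' a : iter_laurent A n')
  else id.

Fixpoint tvar (A : comPzRingType) (n : nat) : 'I_n -> ilaurent A n :=
  if n is n'.+1 return 'I_n -> ilaurent A n then
    fun i => if unlift ord_max i is Some j
             then laurentC (tvar A j : iter_laurent A n') else laurentX
  else fun _ => 0.

Definition mindex (n : nat) : Type := 'I_n -> int.
HB.instance Definition _ n := GRing.Zmodule.on (mindex n).

Definition minit (n : nat) (l : mindex n.+1) : mindex n :=
  fun j => l (lift ord_max j).

Fixpoint icoef (A : comPzRingType) (n : nat) : ilaurent A n -> mindex n -> A :=
  if n is n'.+1 return ilaurent A n -> mindex n -> A then
    fun f l => icoef (lcoef f (l ord_max) : ilaurent A n') (minit l)
  else fun a _ => a.

Definition supp (A : comPzRingType) (n : nat) (f : ilaurent A n) :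
  set (mindex n) := [set l | icoef f l != 0].

(* Since [Lam 0] is a point, [Lam 1 = (int -> unit) * int] is a copy of Z. *)
Fixpoint Lam (n : nat) : Type :=
  if n is n'.+1 then ((int -> Lam n') * int)%type else unit.

Fixpoint Zset (n : nat) : Lam n -> set (mindex n) :=
  if n is n'.+1 return Lam n -> set (mindex n) then
    fun lam => [set l | lam.2 <= l ord_max /\
                        Zset (lam.1 (l ord_max)) (minit l)]
  else fun _ => setT.

Definition Unbhs (A : comPzRingType) (n : nat) (lam : Lam n) :
    set (ilaurent A n) :=
  [set f | supp f `&` -%R @` Zset lam = set0].
Arguments Unbhs : clear implicits.
Arguments Unbhs A {n} lam.

Section Topology.
Variables (A : comPzRingType) (n : nat).

Lemma UnbhsP (lam : Lam n) (f : ilaurent A n) :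
  Unbhs A lam f <-> forall l, Zset lam l -> icoef f (- l) = 0.
Proof.
split=> [fU l lZ|fU].
  apply/eqP/negPn/negP => nz.
  suff : set0 (- l) by [].
  by rewrite -fU; split => //; exists l.
by rewrite /Unbhs /= -subset0 => k [/= nz [l lZ lk]]; case/eqP: nz; rewrite -lk; exact: fU.
Qed.

Definition ilaurent_nbhs (f : ilaurent A n) : set_system (ilaurent A n) :=
  filter_from [set: Lam n] (fun lam => [set g | Unbhs A lam (g - f)]).

Lemma icoefB (k : nat) (f g : ilaurent A k) (l : mindex k) :
  icoef (f - g) l = icoef f l - icoef g l.
Proof. by elim: k f g l => [//|k IH] f g l /=; rewrite -IH. Qed.

Lemma icoef0 (k : nat) (l : mindex k) : icoef (0 : ilaurent A k) l = 0.
Proof. by rewrite -[in LHS](subrr 0) icoefB subrr. Qed.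

Lemma UnbhsB (lam : Lam n) (f g : ilaurent A n) :
  Unbhs A lam f -> Unbhs A lam g -> Unbhs A lam (f - g).
Proof.
move=> /UnbhsP fU /UnbhsP gU; apply/UnbhsP => l lZ.
by rewrite icoefB fU// gU// subrr.
Qed.

Lemma Unbhs0 (lam : Lam n) : Unbhs A lam 0.
Proof. by apply/UnbhsP => l _; exact: icoef0. Qed.

Lemma Lam_inhabited (k : nat) : [set: Lam k] !=set0.
Proof.
by elim: k => [|k [lam _]]; [exists tt | exists (fun=> lam, 0)].
Qed.

Lemma Zset_directed (k : nat) (lam mu : Lam k) :
  exists nu : Lam k, Zset lam `<=` Zset nu /\ Zset mu `<=` Zset nu.
Proof.
elim: k lam mu => [|k IH] lam mu; first by exists tt.
have [nu nuP] := choice (fun i => IH (lam.1 i) (mu.1 i)).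
exists (nu, Num.min lam.2 mu.2); split=> l /= [lz lZ]; have [h1 h2] := nuP (l ord_max).
  by split; [rewrite ge_min lz | exact: h1].
by split; [rewrite ge_min lz orbT | exact: h2].
Qed.

HB.instance Definition _ := hasNbhs.Build (ilaurent A n) ilaurent_nbhs.

Fact ilaurent_nbhs_filter (f : ilaurent A n) : ProperFilter (nbhs f).
Proof.
apply: filter_from_proper => [|lam _]; last first.
  by exists f => /=; rewrite subrr; exact: Unbhs0.
apply: filter_from_filter => [|lam mu _ _]; first exact: Lam_inhabited.
have [nu [lamnu munu]] := Zset_directed lam mu.
exists nu => // g /= /UnbhsP gU.
by split; apply/UnbhsP => l lZ; apply: gU; [exact: lamnu | exact: munu].
Qed.

Fact ilaurent_nbhs_singleton (f : ilaurent A n) (S : set (ilaurent A n)) :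
  nbhs f S -> S f.
Proof. by move=> [lam _]; apply; rewrite /= subrr; exact: Unbhs0. Qed.

Fact ilaurent_nbhs_nbhs (f : ilaurent A n) (S : set (ilaurent A n)) :
  nbhs f S -> nbhs f (nbhs^~ S).
Proof.
move=> [lam _ lamS]; exists lam => // g /= gf; exists lam => // h /= hg.
apply: lamS => /=.
have -> : h - f = (h - g) - (0 - (g - f)) by rewrite sub0r opprK addrA subrK.
by do 2?[apply: UnbhsB => //]; exact: Unbhs0.
Qed.

HB.instance Definition _ := Nbhs_isNbhsTopological.Build (ilaurent A n)
  ilaurent_nbhs_filter ilaurent_nbhs_singleton ilaurent_nbhs_nbhs.

End Topology.

Definition prime_ideal (A : comPzRingType) (p : set A) : Prop :=
  [/\ p 0, forall a b, p a -> p b -> p (a + b), forall a b, p b -> p (a * b),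
      ~ p 1 & forall a b, p (a * b) -> p a \/ p b].

Record Spec (A : comPzRingType) :=
  MkSpec { spec_ideal : set A; spec_idealP : prime_ideal spec_ideal }.

Section SpecTopology.
Variable A : comPzRingType.

HB.instance Definition _ := gen_eqMixin (Spec A).
HB.instance Definition _ := gen_choiceMixin (Spec A).

Definition zariski_open : set_system (Spec A) :=
  [set U | exists S : set A, U = [set p | ~ (S `<=` spec_ideal p)]].

Fact zariski_openT : zariski_open setT.
Proof.
exists setT; apply/seteqP; split=> // p _ /=.
by case: (spec_idealP p) => _ _ _ p1 _ /(_ 1 I).
Qed.

Fact zariski_openI : setI_closed zariski_open.
Proof.
move=> _ _ [S ->] [T ->].
exists [set c | exists a b, [/\ S a, T b & c = a * b]].
apply/seteqP; split=> p /=; case: (spec_idealP p) => _ _ pM _ pP.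
  move=> [Sp Tp] STp.
  have [a Sa pa] : exists2 a, S a & ~ spec_ideal p a.
    by apply: contra_notP Sp => h a Sa; apply: contra_notP h => ?; exists a.
  have [b Tb pb] : exists2 b, T b & ~ spec_ideal p b.
    by apply: contra_notP Tp => h b Tb; apply: contra_notP h => ?; exists b.
  have /pP[] : spec_ideal p (a * b) by apply: STp; exists a, b.
  - exact: pa.
  - exact: pb.
move=> STp; split=> h; apply: STp => _ [a [b [Sa Tb ->]]].
  by rewrite mulrC; apply/pM/h.
exact/pM/h.
Qed.

Fact zariski_open_bigU (I : Type) (U : I -> set (Spec A)) :
  (forall i, zariski_open (U i)) -> zariski_open (\bigcup_i U i).
Proof.
move=> /choice[S SU]; exists (\bigcup_i S i); apply/seteqP; split=> p /=.
  by move=> [i _]; rewrite SU /= => nS h; apply: nS => a Sa; apply: h; exists i.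
apply: contra_notP => h a [i _ Sa]; apply: contra_notP h => pa.
by exists i => //; rewrite SU /= => /(_ a Sa).
Qed.

HB.instance Definition _ := isOpenTopological.Build (Spec A)
  zariski_openT zariski_openI zariski_open_bigU.

End SpecTopology.

Fact comap_prime (A B : comPzRingType) (h : {rmorphism A -> B}) (q : Spec B) :
  prime_ideal (h @^-1` spec_ideal q).
Proof.
case: (spec_idealP q) => q0 qD qM q1 qP; split=> [|a b|a b||a b] /=.
- by rewrite rmorph0.
- by rewrite rmorphD; exact: qD.
- by rewrite rmorphM; exact: qM.
- by rewrite rmorph1.
- by rewrite rmorphM; exact: qP.
Qed.

Definition comap (A B : comPzRingType) (h : {rmorphism A -> B}) (q : Spec B) :
  Spec A := MkSpec (comap_prime h q).

Definition locally_constant (T : topologicalType) (U : Type) (c : T -> U) :=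
  forall p, \forall q \near p, c q = c p.

Section LocallyConstant.
Variable A : comPzRingType.

Definition Zbar_pred : {pred Spec A -> int} := fun c => `[< locally_constant c >].

Lemma Zbar_subring_closed : subring_closed Zbar_pred.
Proof.
split=> [|c d /asboolP hc /asboolP hd|c d /asboolP hc /asboolP hd].
- by apply/asboolP => p; near=> q.
- apply/asboolP => p; near=> q.
  rewrite -[LHS]/(c q - d q) -[RHS]/(c p - d p).
  by congr (_ - _); near: q; [exact: hc | exact: hd].
- apply/asboolP => p; near=> q.
  rewrite -[LHS]/(c q * d q) -[RHS]/(c p * d p).
  by congr (_ * _); near: q; [exact: hc | exact: hd].
Unshelve. all: by end_near. Qed.

HB.instance Definition _ := GRing.isSubringClosed.Build (Spec A -> int)
  Zbar_pred Zbar_subring_closed.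

Record Zbar := MkZbar { Zval :> Spec A -> int; ZvalP : Zval \in Zbar_pred }.

HB.instance Definition _ := [isSub for Zval].
HB.instance Definition _ := [Choice of Zbar by <:].
HB.instance Definition _ :=
  GRing.SubChoice_isSubComPzRing.Build _ _ Zbar Zbar_subring_closed.

Lemma Zbar_locally_constant (c : Zbar) : locally_constant c.
Proof. exact/asboolP/ZvalP. Qed.

End LocallyConstant.

(* An isomorphism A ~ prod_i A_i with finitely many factors, given by its
   components A -> A_i. *)
Record decomposition (A : comPzRingType) := Decomposition {
  dsize : nat;
  dfactor : 'I_dsize -> comPzRingType;
  dproj : forall i, {rmorphism A -> dfactor i};
  dproj_bij : bijective (fun (a : A) (i : 'I_dsize) => dproj i a) }.
Arguments dsize {A} d.
Arguments dfactor {A} d i.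
Arguments dproj {A} d i.

(* c takes the value z i on Spec(A_i). *)
Definition takes_values (A : comPzRingType) (U : Type) (c : Spec A -> U)
    (D : decomposition A) (z : 'I_(dsize D) -> U) : Prop :=
  forall i (q : Spec (dfactor D i)), c (comap (dproj D i) q) = z i.

(* The natural homomorphism from [Zbar A] to A. The defining property determines
   the value uniquely, whatever the decomposition. *)
Definition Zbar_to_ring (A : comPzRingType) (c : Zbar A) : A :=
  xget 0 [set a : A | exists (D : decomposition A) (z : 'I_(dsize D) -> int),
    takes_values c z /\ forall i, dproj D i a = (z i)%:~R].

(* Lexicographic order comparing the last coordinates first. *)
Fixpoint lexle (n : nat) : mindex n -> mindex n -> Prop :=
  if n is n'.+1 return mindex n -> mindex n -> Prop then
    fun l l' => l ord_max < l' ord_max \/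
                (l ord_max = l' ord_max /\ lexle (minit l) (minit l'))
  else fun _ _ => True.

Definition lexlt (n : nat) (l l' : mindex n) : Prop := lexle l l' /\ l <> l'.

Definition nilpotent (A : comPzRingType) (a : A) := exists k : nat, a ^+ k = 0.
Definition invertible (A : comPzRingType) (a : A) := exists b : A, a * b = 1.

Definition is_nu (A : comPzRingType) (n : nat) (f : ilaurent A n)
    (v : 'cV[Zbar A]_n) : Prop :=
  exists (D : decomposition A) (l : 'I_(dsize D) -> mindex n),
    [/\ forall i k, lexlt k (l i) -> nilpotent (dproj D i (icoef f k)),
        forall i, invertible (dproj D i (icoef f (l i))) &
        takes_values (fun p => (fun j => v j 0 p) : mindex n) l].

(* [nu f] is the unique v such that [is_nu f v] when f is invertible, and is
   meaningless otherwise. *)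
Definition nu (A : comPzRingType) (n : nat) (f : ilaurent A n) :
  'cV[Zbar A]_n := xget 0 [set v | is_nu f v].

Definition Upsilon (A : comPzRingType) (n m : nat)
    (phi : ilaurent A n -> ilaurent A m) : 'M[Zbar A]_(m, n) :=
  \matrix_(j < m, i < n) nu (phi (tvar A i)) j 0.

(* [lead_val v p] is the value at p of the leading entry of the column v, i.e.
   of the entry v_k with v_k(p) > 0 and v_j(p) = 0 for all j > k; it is 0 if
   there is no such k. *)
Definition lead_val (A : comPzRingType) (m : nat) (v : 'cV[Zbar A]_m)
    (p : Spec A) : int :=
  if [pick k : 'I_m | (0 < v k 0 p) &&
                      [forall j : 'I_m, (k < j)%N ==> (v j 0 p == 0)]] is Some k
  then v k 0 p else 0.

Fact lead_valP (A : comPzRingType) (m : nat) (v : 'cV[Zbar A]_m) :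
  lead_val v \in @Zbar_pred A.
Proof.
apply/asboolP => p.
have vp : \forall q \near p, forall j : 'I_m, v j 0 q = v j 0 p.
  apply: (@filter_forall _ _ (fun (j : 'I_m) q => v j 0 q = v j 0 p) _
    (nbhs_filter p)) => j.
  exact: Zbar_locally_constant.
near=> q; have vq : forall j, v j 0 q = v j 0 p by near: q.
rewrite /lead_val (@eq_pick _ _ (fun k : 'I_m => (0 < v k 0 p) &&
  [forall j : 'I_m, (k < j)%N ==> (v j 0 p == 0)])); first by case: pickP.
move=> k /=; rewrite vq; congr (_ && _); apply: eq_forallb => j.
by rewrite vq.
Unshelve. all: by end_near. Qed.

Definition lead (A : comPzRingType) (m : nat) (v : 'cV[Zbar A]_m) : Zbar A :=
  MkZbar (lead_valP v).

(* When phi is a continuous homomorphism of A-algebras with n, m > 0, Upsilon(phi)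
   is in column echelon form with positive leading entries, so every [lead] below
   is the leading entry of a column and the pivots are p_1 < ... < p_n. *)
Definition dinvariant (A : comPzRingType) (n m : nat)
    (phi : ilaurent A n -> ilaurent A m) : Zbar A :=
  \prod_(i < n) lead (col i (Upsilon phi)).

(* Main.v *)
Require Import Defs.
From mathcomp Require Import all_boot all_order all_algebra.
From mathcomp Require Import zify ring.
From mathcomp Require Import all_classical all_analysis.

Set Implicit Arguments.
Unset Strict Implicit.
Unset Printing Implicit Defensive.

Import Order.TTheory GRing.Theory Num.Theory.
Local Open Scope classical_set_scope.
Local Open Scope ring_scope.

(* Write X(k) for the image of t^k. If the kernel of phi is stable under the
   Hasse derivatives a_k t^k |-> binom(k_i, s) a_k t^k, then integer-valued
   polynomials in k isolate each term: phi(f) = 0 gives a_k X(k) = 0, so a_k = 0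
   as X(k) is a unit.

   Stability is proved by induction on s. Let S be the Hasse-Schmidt family on
   L^m(A) whose first-order part is a vector field v with v(x_i) = D x_i and
   v(x_j) = 0 for j <> i, where x_j = phi(t_j). Expanding S_s(phi(f)) = 0 to
   order s, all terms vanish by induction except D^s phi(binom(k_i, s) f).
   Cramer's rule yields v with D the determinant of the logarithmic derivatives
   (t_p d/dt_p)(x_j) / x_j at the pivot coordinates p. On a component of Spec A
   where the valuations l_j of the x_j are constant, x_j is the sum of a
   nilpotent element and of a series with lowest exponent l_j, hence D is, up to
   a nilpotent element, a series with lowest term d(phi); so D is regular. *)

(** * Iterated Laurent series *)

(** Nonzero integers may be zero divisors or zero in A, so nothing may be divided by s!. Hence
    divided derivatives replace the powers of t_i d/dt_i, interpolation uses binomials with integer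
    coefficients, and the adjugate replaces an inverse matrix. A valuation only says that the
    coefficients of x_j below l_j are nilpotent one by one, which does not make their sum nilpotent.
    For a unit it does, and the proof goes through the idempotents of L^n(A), which are constants.
    Derivations need not preserve nilpotents either; first-order parts of Hasse-Schmidt families do.
    That the pivots increase comes from continuity: for i < i', a monomial t_i'^b t_i^(-a) is small
    once b is large, whatever a is, whereas pivots in the wrong order would keep its image away from
    zero for a suitable a. As series are infinite sums, identities are checked on monomials and
    extended by continuity. *)

Section Laurent.
Variable B : comPzRingType.
Implicit Types f g : laurent B.

Lemma lcoef_bounded f : exists N : int, forall i, i < N -> lcoef f i = 0.
Proof. exact/laurent_predP/lcoefP. Qed.

Lemma lcoefD f g i : lcoef (f + g) i = lcoef f i + lcoef g i.
Proof. by []. Qed.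

Lemma lcoefN f i : lcoef (- f) i = - lcoef f i.
Proof. by []. Qed.

Lemma lcoefB f g i : lcoef (f - g) i = lcoef f i - lcoef g i.
Proof. by []. Qed.

Lemma lcoef1 i : lcoef (1 : laurent B) i = if i == 0 then 1 else 0.
Proof. by []. Qed.

Lemma lcoefM f g (N M k : int) (d : nat) :
  (forall i, i < N -> lcoef f i = 0) -> (forall i, i < M -> lcoef g i = 0) ->
  k - N - M < d%:Z ->
  lcoef (f * g) k =
    \sum_(j < d) lcoef f (N + j%:Z) * lcoef g (k - (N + j%:Z)).
Proof. exact: cauchy_prodE. Qed.

Lemma lcoefM_lt f g (N M : int) :
  (forall i, i < N -> lcoef f i = 0) -> (forall i, i < M -> lcoef g i = 0) ->
  forall k, k < N + M -> lcoef (f * g) k = 0.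
Proof. exact: cauchy_prod_bounded. Qed.

Lemma lcoefM_lead f g (N M : int) :
  (forall i, i < N -> lcoef f i = 0) -> (forall i, i < M -> lcoef g i = 0) ->
  lcoef (f * g) (N + M) = lcoef f N * lcoef g M.
Proof.
move=> fN gM; rewrite (@lcoefM _ _ N M _ 1)//; last by lia.
by rewrite big_ord1 addr0 addrAC subrr add0r.
Qed.

Lemma laurent_eq f g : (forall i, lcoef f i = lcoef g i) -> f = g.
Proof. by move=> fg; apply/laurentP/funext. Qed.

Lemma lmonP (i : int) (b : B) : (fun j => if j == i then b else 0) \in @laurent_pred B.
Proof. by apply/laurent_predP; exists i => j; case: eqP => // ->; rewrite ltxx. Qed.

Definition lmon i b : laurent B := Laurent (lmonP i b).

Lemma lcoef_lmon i b j : lcoef (lmon i b) j = if j == i then b else 0.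
Proof. by []. Qed.

Lemma lmonD i a b : lmon i (a + b) = lmon i a + lmon i b.
Proof.
by apply: laurent_eq => j; rewrite lcoefD !lcoef_lmon; case: eqP; rewrite ?addr0.
Qed.

Lemma lcoef_lmonM i b f k : lcoef (lmon i b * f) k = b * lcoef f (k - i).
Proof.
have [M fM] := lcoef_bounded f.
rewrite (@lcoefM _ _ i M k `|(k - i - M)%R|.+1)//; first last.
- by lia.
- by move=> j ji; rewrite lcoef_lmon lt_eqF.
rewrite big_ord_recl big1 ?addr0 => [|j _].
  by rewrite lcoef_lmon eqxx.
by rewrite lcoef_lmon lift0 ifF ?mul0r//; apply/eqP; lia.
Qed.

Lemma lmonM i j a b : lmon i a * lmon j b = lmon (i + j) (a * b).
Proof.
apply: laurent_eq => k; rewrite lcoef_lmonM !lcoef_lmon.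
have -> : (k - i == j) = (k == i + j) by lia.
by case: eqP; rewrite ?mulr0.
Qed.

Lemma lmon_nilpotent i b : nilpotent b -> nilpotent (lmon i b).
Proof.
move=> [k bk]; exists k.
have -> : lmon i b ^+ k = lmon (i *+ k) (b ^+ k).
  elim: k {bk} => [|k IH]; last by rewrite !exprS mulrS IH lmonM.
  by apply: laurent_eq => j; rewrite lcoef_lmon lcoef1.
by rewrite bk; apply: laurent_eq => j; rewrite lcoef_lmon; case: eqP.
Qed.

Variables (h : int -> B -> B) (h0 : forall i, h i 0 = 0).

Lemma lmapP f : (fun i => h i (lcoef f i)) \in @laurent_pred B.
Proof.
have [N fN] := lcoef_bounded f.
by apply/laurent_predP; exists N => i iN; rewrite fN.
Qed.

End Laurent.

Section MultiIndex.
Variable n : nat.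
Implicit Types k l : mindex n.+1.

Lemma mindexP k l : k ord_max = l ord_max -> minit k = minit l -> k = l.
Proof.
move=> klm kli; apply/funext => j; case: (unliftP ord_max j) => [i ->|->//].
exact: (congr1 (@^~ i) kli).
Qed.

Definition mcons (i : int) (l : mindex n) : mindex n.+1 :=
  fun j => if unlift ord_max j is Some j' then l j' else i.

Lemma mcons_max i (l : mindex n) : mcons i l ord_max = i.
Proof. by rewrite /mcons unlift_none. Qed.

Lemma minit_mcons i (l : mindex n) : minit (mcons i l) = l.
Proof. by apply/funext => j; rewrite /minit /mcons liftK. Qed.

Lemma mconsK k : mcons (k ord_max) (minit k) = k.
Proof. by apply: mindexP; rewrite ?mcons_max ?minit_mcons. Qed.

Lemma minitN k : minit (- k) = - minit k.
Proof. by []. Qed.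

Lemma lexltS k l : lexlt k l <->
  (k ord_max < l ord_max) \/ (k ord_max = l ord_max /\ lexlt (minit k) (minit l)).
Proof.
split=> [[[lt|[eq le]] kl]|[lt|[eq [le kl]]]]; [by left| | |].
- by right; split=> //; split=> // kli; apply: kl; apply: mindexP.
- by split; [left|move=> kl; rewrite kl ltxx in lt].
- by split; [right|move=> klE; rewrite klE in kl].
Qed.

End MultiIndex.

Lemma mindex0 (k l : mindex 0) : k = l.
Proof. by apply/funext => -[]. Qed.

Section IteratedLaurent.
Variable A : comPzRingType.

Lemma icoefD n (f g : ilaurent A n) l : icoef (f + g) l = icoef f l + icoef g l.
Proof. by elim: n f g l => [//|n IH] f g l /=; rewrite -IH. Qed.

Lemma icoefN n (f : ilaurent A n) l : icoef (- f) l = - icoef f l.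
Proof. by rewrite -sub0r icoefB icoef0 sub0r. Qed.

Lemma icoef_inj n (f g : ilaurent A n) : (forall l, icoef f l = icoef g l) -> f = g.
Proof.
elim: n f g => [|n IH] f g fg; first exact: (fg 0).
apply: laurent_eq => i; apply: IH => l.
by have := fg (mcons i l); rewrite /= mcons_max minit_mcons.
Qed.

Fixpoint mono n (a : A) : mindex n -> ilaurent A n :=
  if n is n'.+1 return mindex n -> ilaurent A n then
    fun k => lmon (k ord_max) (mono a (minit k) : iter_laurent A n')
  else fun=> a.

Lemma icoef_mono n a (k l : mindex n) :
  icoef (mono a k) l = if l == k then a else 0.
Proof.
elim: n k l => [|n IH] k l; first by rewrite /= (mindex0 l k) eqxx.
have /= -> : (l == k) = (l ord_max == k ord_max) && (minit l == minit k).
  apply/eqP/andP => [->//|[/eqP lk /eqP]]; exact: mindexP.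
by case: (l ord_max == k ord_max); [exact: IH|exact: icoef0].
Qed.

Lemma monoD n a b (k : mindex n) : mono (a + b) k = mono a k + mono b k.
Proof.
by apply: icoef_inj => l; rewrite icoefD !icoef_mono; case: eqP; rewrite ?addr0.
Qed.

Lemma mono0 n (k : mindex n) : mono 0 k = 0.
Proof. by apply: icoef_inj => l; rewrite icoef_mono icoef0; case: eqP. Qed.

Lemma monoM n a b (k l : mindex n) : mono a k * mono b l = mono (a * b) (k + l).
Proof.
elim: n k l => [//|n IH] k l.
by rewrite /= -[minit (k + l)]/(minit k + minit l) -IH -lmonM.
Qed.

Lemma mono1 n : mono 1 (0 : mindex n) = 1.
Proof.
elim: n => [//|n IH]; apply: laurent_eq => i.
by rewrite /= -[minit 0]/(0 : mindex n) IH.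
Qed.

Lemma ilaurentC_mono n a : ilaurentC n a = mono a (0 : mindex n).
Proof.
elim: n => [//|n IH]; apply: laurent_eq => i.
by rewrite /= -[minit 0]/(0 : mindex n) -IH.
Qed.

Lemma icoef1 n (l : mindex n) : icoef (1 : ilaurent A n) l = if l == 0 then 1 else 0.
Proof. by rewrite -mono1 icoef_mono. Qed.

Lemma icoef_mono0M n (a : A) (f : ilaurent A n) l :
  icoef (mono a 0 * f) l = a * icoef f l.
Proof.
elim: n f l => [//|n IH] f l.
have := lcoef_lmonM 0 (mono a (0 : mindex n) : iter_laurent A n) f (l ord_max).
rewrite subr0 => E; have := IH (lcoef f (l ord_max)) (minit l).
by move: E => /= <-.
Qed.

Definition mbase n (i : 'I_n) : mindex n := fun j => (i == j)%:Z.

Lemma tvar_mono n (i : 'I_n) : tvar A i = mono 1 (mbase i).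
Proof.
elim: n i => [|n IH] i; first by case: i.
rewrite /=; case: unliftP => [j|] ->; last first.
  apply: laurent_eq => k; rewrite lcoef_lmon /= /monomial_fun /mbase eqxx.
  have -> : minit (mbase (ord_max : 'I_n.+1)) = 0.
    by apply/funext => j; rewrite /minit /mbase (negbTE (neq_lift _ _)).
  by rewrite mono1.
apply: laurent_eq => k; rewrite lcoef_lmon /= /const_fun IH.
have -> : mbase (lift ord_max j) ord_max = 0.
  by rewrite /mbase eq_sym (negbTE (neq_lift _ _)).
case: eqP => // _; congr mono; apply/funext => j'.
by rewrite /minit /mbase (inj_eq lift_inj).
Qed.

(* The test b == 0 only makes it evident that the coefficientwise map preserves 0. *)
Fixpoint dop n : (mindex n -> int) -> ilaurent A n -> ilaurent A n :=
  if n is n'.+1 return (mindex n -> int) -> ilaurent A n -> ilaurent A n then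
    fun c f => Laurent (lmapP (h := fun i (b : iter_laurent A n') =>
      if b == 0 then 0 else dop (fun l => c (mcons i l)) b)
      (fun=> ifT _ _ (eqxx 0)) f)
  else fun c a => a *~ c 0.

Lemma icoef_dop n c (f : ilaurent A n) k : icoef (dop c f) k = icoef f k *~ c k.
Proof.
elim: n c f k => [|n IH] c f k /=; first by rewrite (mindex0 k 0).
case: eqP => [->|_]; last by rewrite IH mconsK.
by rewrite !(icoef0 A) mul0rz.
Qed.

Lemma dopD n c (f g : ilaurent A n) : dop c (f + g) = dop c f + dop c g.
Proof.
by apply: icoef_inj => k; rewrite icoefD !icoef_dop icoefD mulrzDl.
Qed.

Lemma dop_mono n c a (k : mindex n) : dop c (mono a k) = mono (a *~ c k) k.
Proof.
apply: icoef_inj => l; rewrite icoef_dop !icoef_mono.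
by case: eqP => [->//|_]; rewrite mul0rz.
Qed.

Definition inU n (lam : Lam n) (f : ilaurent A n) :=
  forall l, Zset lam l -> icoef f (- l) = 0.

Lemma inUS n (lam : Lam n.+1) (f : ilaurent A n.+1) :
  inU lam f <-> forall i, lam.2 <= i -> inU (lam.1 i) (lcoef f (- i) : ilaurent A n).
Proof.
split=> fU.
  move=> i lami l lZ; have := fU (mcons i l); rewrite /= mcons_max minit_mcons.
  by move=> /(_ (conj lami lZ)); rewrite minitN minit_mcons opprfctE mcons_max.
by move=> l [lami lZ]; exact: fU lZ.
Qed.

Lemma inU_sub n (lam mu : Lam n) (f : ilaurent A n) :
  Zset lam `<=` Zset mu -> inU mu f -> inU lam f.
Proof. by move=> lm fU l lZ; apply/fU/lm. Qed.

Lemma inUD n (lam : Lam n) (f g : ilaurent A n) :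
  inU lam f -> inU lam g -> inU lam (f + g).
Proof. by move=> fU gU l lZ; rewrite icoefD fU// gU// addr0. Qed.

Lemma inU0 n (lam : Lam n) : inU lam (0 : ilaurent A n).
Proof. by move=> l _; rewrite icoef0. Qed.

Lemma inU_sum n (lam : Lam n) (I : Type) (r : seq I) (P : pred I) (F : I -> ilaurent A n) :
  (forall i, P i -> inU lam (F i)) -> inU lam (\sum_(i <- r | P i) F i).
Proof.
move=> FU; elim/big_ind : _ => //; first exact: inU0.
by move=> f g; apply: inUD.
Qed.

Lemma inU_dop n (lam : Lam n) c (f : ilaurent A n) : inU lam f -> inU lam (dop c f).
Proof. by move=> fU l lZ; rewrite icoef_dop fU// mul0rz. Qed.

Lemma Zset_directed_fin n (d : nat) (lam : nat -> Lam n) :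
  exists mu, forall j, (j < d)%N -> Zset (lam j) `<=` Zset mu.
Proof.
elim: d => [|d [mu muP]]; first by exists (lam 0%N).
have [nu [munu lamnu]] := Zset_directed mu (lam d).
exists nu => j; rewrite ltnS leq_eqVlt => /orP[/eqP ->//|/muP lm].
exact: subset_trans lm munu.
Qed.

(** Continuity at zero, spelled out on the basic neighborhoods; for additive maps this amounts to
    continuity. *)
Definition ucont n m (F : ilaurent A n -> ilaurent A m) :=
  forall lam, exists mu, forall f, inU mu f -> inU lam (F f).

(** For given [i], the coefficient of [f] at [- i] enters only finitely many constrained terms of
    [c * f]: [c] is bounded below, and the constraint bounds its index above. Directedness merges
    these conditions. *)
Lemma ucont_mul n (c : ilaurent A n) : ucont (fun f => c * f).
Proof.
elim: n c => [|n IH] c lam.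
  exists tt => f fU l lZ /=; have /= -> := fU 0 I; exact: mulr0.
have [N cN] := lcoef_bounded (c : laurent (iter_laurent A n)).
have /choice[al alP] : forall ij : int * int, exists al : Lam n, forall f : ilaurent A n,
    inU al f -> inU (lam.1 ij.1) ((lcoef c ij.2 : ilaurent A n) * f).
  by move=> ij; exact: IH.
(* c_a f_(-i) contributes to the coefficient a - i, constrained when a <= i - lam.2. *)
have /choice[mu muP] : forall i : int, exists mu : Lam n, forall j,
   (j < `|(i - lam.2 - N + 1)%R|)%N ->
   Zset (al (i - (N + j%:Z), N + j%:Z)) `<=` Zset mu.
  by move=> i; apply: (Zset_directed_fin _ (fun j => al (i - (N + j%:Z), N + j%:Z))).
exists (mu, lam.2 + N) => f /inUS /= fU; apply/inUS => i ilam.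
have [M fM] := lcoef_bounded (f : laurent (iter_laurent A n)).
pose d := `|(- i - N - M + 1)%R|%N.
have -> := @lcoefM _ (c : laurent (iter_laurent A n)) f N M (- i) d cN fM.
  apply: inU_sum => j _.
  have e : - i - (N + j%:Z) = - (i + (N + j%:Z)) by lia.
  rewrite e.
  have /(muP (i + (N + j%:Z))) lm : (j < `|(i + (N + j%:Z) - lam.2 - N + 1)%R|)%N by lia.
  have e2 : i + (N + j%:Z) - (N + j%:Z) = i by lia.
  rewrite e2 in lm.
  apply: (alP (i, N + j%:Z)); apply: (inU_sub lm); apply: fU; lia.
by rewrite /d; lia.
Qed.

Lemma inU_icoef n (l : mindex n) : exists lam, forall f : ilaurent A n, inU lam f -> icoef f l = 0.
Proof.
elim: n l => [|n IH] l.
  by exists tt => f /(_ 0 I).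
have [lam lamP] := IH (minit l).
exists (fun=> lam, - l ord_max) => f /inUS /= /(_ (- l ord_max) (lexx _)).
by rewrite opprK; exact: lamP.
Qed.

(** Modulo a basic neighborhood only finitely many outer coefficients of a series matter, and each
    is handled by the induction on [n]. *)
Lemma density n (V : zmodType) (F : ilaurent A n -> V) (lam : Lam n) :
  {morph F : f g / f + g} -> (forall f, inU lam f -> F f = 0) ->
  (forall a k, F (mono a k) = 0) -> forall f, F f = 0.
Proof.
elim: n F lam => [|n IH] F lam FD FU Fm f; first exact: (Fm f 0).
have Fl i (b : iter_laurent A n) : F (lmon i b) = 0.
  apply: (IH (fun c : ilaurent A n => F (lmon i (c : iter_laurent A n)))
    (lam.1 (- i)) _ _ _ b) => [a b'|a aU|a k].
  - by rewrite lmonD FD.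
  - apply: FU; apply/inUS => j jl; rewrite lcoef_lmon; case: eqP => [ji|_].
      by rewrite -ji opprK in aU.
    exact: inU0.
  - have := Fm a (mcons i k); by rewrite /= mcons_max minit_mcons.
have claim d : forall f : laurent (iter_laurent A n),
    (forall i, i < 1 - lam.2 - d%:Z -> lcoef f i = 0) -> F f = 0.
  elim: d => [|d IHd] g gd.
    apply: FU; apply/inUS => i il; rewrite gd; [exact: inU0|lia].
  pose i := - lam.2 - d%:Z.
  rewrite -(subrK (lmon i (lcoef g i)) g) FD Fl addr0.
  apply: IHd => j jd; rewrite lcoefB lcoef_lmon; case: eqP => [->|ji].
    exact: subrr.
  by rewrite gd ?subr0//; lia.
have [N fN] := lcoef_bounded (f : laurent (iter_laurent A n)).
apply: (claim `|(1 - lam.2 - N)%R|%N) => i iN; apply: fN; lia.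
Qed.

Definition suppge n (l : mindex n) (f : ilaurent A n) :=
  forall k, lexlt k l -> icoef f k = 0.

Lemma suppgeD n (l : mindex n) f g : suppge l f -> suppge l g -> suppge l (f + g).
Proof. by move=> fl gl k kl; rewrite icoefD fl// gl// addr0. Qed.

Lemma suppgeN n (l : mindex n) f : suppge l f -> suppge l (- f).
Proof. by move=> fl k kl; rewrite icoefN fl// oppr0. Qed.

Lemma suppge_dop n (l : mindex n) c f : suppge l f -> suppge l (dop c f).
Proof. by move=> fl k kl; rewrite icoef_dop fl// mul0rz. Qed.

Lemma suppgeS n (l : mindex n.+1) (f : ilaurent A n.+1) : suppge l f <->
  (forall i, i < l ord_max -> lcoef f i = 0) /\
  suppge (minit l) (lcoef f (l ord_max) : ilaurent A n).
Proof.
split=> [fl|[fi fl] k /lexltS[kl|[kl kl']]].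
- split=> [i il|k kl].
    apply: (@icoef_inj n) => k; have := fl (mcons i k).
    rewrite /= mcons_max minit_mcons (icoef0 A) => -> //.
    by apply/lexltS; left; rewrite mcons_max.
  have := fl (mcons (l ord_max) k); rewrite /= mcons_max minit_mcons => -> //.
  by apply/lexltS; right; rewrite mcons_max minit_mcons.
- by rewrite /= fi// (icoef0 A).
- by rewrite /= kl fl.
Qed.

Lemma suppge_mul n (l l' : mindex n) f g : suppge l f -> suppge l' g ->
  suppge (l + l') (f * g) /\ icoef (f * g) (l + l') = icoef f l * icoef g l'.
Proof.
elim: n l l' f g => [|n IH] l l' f g; first by move=> _ _; split=> // k [_ []]; apply: mindex0.
move=> /suppgeS[fl fl'] /suppgeS[gl gl'].
have [IH1 IH2] := IH _ _ _ _ fl' gl'.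
have lead := lcoefM_lead fl gl; split; last first.
  by rewrite -IH2 /=; congr (icoef _ _); exact: lead.
apply/suppgeS; split; first exact: (lcoefM_lt fl gl).
by move: IH1; rewrite -lead.
Qed.

Lemma int_min (P : int -> Prop) (N : int) : (forall i, i < N -> ~ P i) ->
  (exists i, P i) -> exists2 i, P i & forall j, j < i -> ~ P j.
Proof.
move=> PN [i Pi].
have ex : exists k, `[< P (N + k%:Z) >].
  exists `|i - N|%N; apply/asboolP; have -> : N + `|i - N|%N%:Z = i; last by [].
  have : ~ (i < N) by move=> /PN; apply.
  by lia.
case: (ex_minnP ex) => k /asboolP Pk kmin; exists (N + k%:Z) => // j jk Pj.
have Nj : ~ (j < N) by move=> /PN; apply.
have : `[< P (N + `|(j - N)%R|%N%:Z) >].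
  by apply/asboolP; have -> : N + `|(j - N)%R|%N%:Z = j by lia.
by move=> /kmin; lia.
Qed.

(** The lexicographic order on Z^n is not well-founded; a minimum exists because, the later
    coordinates being fixed, each coordinate is bounded below on the support. *)
Lemma lexmin n (f : ilaurent A n) : f <> 0 -> exists2 k, icoef f k <> 0 & suppge k f.
Proof.
elim: n f => [|n IH] f f0.
  by exists 0 => // k [_ []]; exact: mindex0.
have [N fN] := lcoef_bounded (f : laurent (iter_laurent A n)).
have [i fi imin] : exists2 i, lcoef f i <> 0 & forall j, j < i -> ~ (lcoef f j <> 0).
  apply: (@int_min (fun i => lcoef f i <> 0) N) => [i /fN fi0 //|].
  apply: contra_notP f0 => fz; apply: laurent_eq => i.
  by apply: contra_notP fz => fz; exists i.
have [k fk kmin] := IH _ fi.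
exists (mcons i k); first by rewrite /= mcons_max minit_mcons.
apply/suppgeS; rewrite mcons_max minit_mcons; split => // j /imin.
by move=> /contrapT.
Qed.

End IteratedLaurent.

(** * Hasse-Schmidt families *)

(** The binomial coefficient of an arbitrary integer: [Negz k] is -(k+1), and upper negation gives
    (-1)^s C(k+s, s). *)
Definition binz (k : int) (s : nat) : int :=
  match k with
  | Posz k => 'C(k, s)%:Z
  | Negz k => (-1) ^+ s * 'C(k + s, s)%:Z
  end.

Lemma binz0 k : binz k 0 = 1.
Proof. by case: k => k; rewrite /= bin0 ?mul1r. Qed.

Lemma binz1 k : binz k 1 = k.
Proof. by case: k => k; rewrite /= bin1// addn1 expr1 NegzE mulN1r. Qed.

Lemma binz0n s : binz 0 s = (s == 0%N)%:Z.
Proof. by rewrite /= bin0n. Qed.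

Lemma binzS k s : binz (k + 1) s.+1 = binz k s.+1 + binz k s.
Proof.
case: k => [k|[|k]].
- have -> : (Posz k + 1)%R = Posz k.+1 by lia.
  by rewrite /= binS PoszD.
- have -> : (Negz 0 + 1)%R = 0 by lia.
  rewrite binz0n /= add0n !add0n !binn exprS; ring.
- have -> : (Negz k.+1 + 1)%R = Negz k by lia.
  rewrite /= addSnnS (addnS k s.+1) binS PoszD -addSnnS exprS; ring.
Qed.

Lemma int_ind2 (P : int -> Prop) : P 0 -> (forall k, P k <-> P (k + 1)) -> forall k, P k.
Proof.
move=> P0 PS; apply: int_rect => // k; first by rewrite -addn1 PoszD => /PS.
by move=> Pk; apply/PS; have -> : (- k.+1%:Z + 1)%R = - k%:Z by lia.
Qed.

(** Pascal's recursion can also be run towards negative [k], by induction on [s], so the row at 0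
    determines the whole table. *)
Lemma pascal_unique (f g : int -> nat -> int) :
  (forall s, f 0 s = g 0 s) ->
  (forall k, f (k + 1) 0%N = f k 0%N) -> (forall k, g (k + 1) 0%N = g k 0%N) ->
  (forall k s, f (k + 1) s.+1 = f k s.+1 + f k s) ->
  (forall k s, g (k + 1) s.+1 = g k s.+1 + g k s) -> forall k s, f k s = g k s.
Proof.
move=> fg0 f0 g0 fS gS; apply: int_ind2 => // k; split=> fg.
  by case=> [|s]; rewrite ?f0 ?g0 // fS gS !fg.
elim=> [|s IH]; first by rewrite -f0 -g0.
by apply: (addIr (f k s)); rewrite -fS fg gS IH.
Qed.

(** Both sides obey Pascal's recursion in [k], which covers negative arguments. *)
Lemma binz_vandermonde k l s :
  binz (k + l) s = \sum_(i < s.+1) binz k i * binz l (s - i).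
Proof.
move: k s; apply: pascal_unique => [s|k|k|k s|k s].
- rewrite add0r big_ord_recl big1 => [|i _]; first by rewrite binz0 mul1r subn0 addr0.
  by rewrite binz0n mul0r.
- by rewrite !binz0.
- by rewrite !big_ord1 !binz0.
- by rewrite addrAC binzS.
- rewrite big_ord_recl [in RHS]big_ord_recl /= !binz0 -!addrA; congr (_ + _).
  by rewrite -big_split; apply: eq_bigr => i _; rewrite /= binzS mulrDl subSS.
Qed.

Section Continuity.
Variable A : comPzRingType.

Lemma ucont_comp n m p (F : ilaurent A m -> ilaurent A p) (G : ilaurent A n -> ilaurent A m) :
  ucont F -> ucont G -> ucont (F \o G).
Proof.
move=> Fc Gc lam; have [mu muP] := Fc lam; have [nu nuP] := Gc mu.
by exists nu => f /nuP /muP.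
Qed.

Lemma ucont_add n m (F G : ilaurent A n -> ilaurent A m) :
  ucont F -> ucont G -> ucont (fun f => F f + G f).
Proof.
move=> Fc Gc lam; have [mu muP] := Fc lam; have [nu nuP] := Gc lam.
have [ka [k1 k2]] := Zset_directed mu nu; exists ka => f fU.
by apply: inUD; [apply/muP/(inU_sub k1)|apply/nuP/(inU_sub k2)].
Qed.

Lemma ucont_zero n m : ucont (fun _ : ilaurent A n => 0 : ilaurent A m).
Proof. by move=> lam; have [mu _] := Lam_inhabited n; exists mu => f _; apply: inU0. Qed.

Lemma ucont_sum n m (I : Type) (r : seq I) (F : I -> ilaurent A n -> ilaurent A m) :
  (forall i, ucont (F i)) -> ucont (fun f => \sum_(i <- r) F i f).
Proof.
move=> Fc; elim: r => [|i r IH] lam.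
  have [mu muP] := ucont_zero n lam.
  by exists mu => f /muP; rewrite big_nil.
have [mu muP] := ucont_add (Fc i) IH lam.
by exists mu => f /muP; rewrite big_cons.
Qed.

Lemma ucont_dop n c : ucont (@dop A n c).
Proof. by move=> lam; exists lam => f; apply: inU_dop. Qed.

Lemma ucont_id n : ucont (fun f : ilaurent A n => f).
Proof. by move=> lam; exists lam. Qed.

Lemma ucont_mull n m (c : ilaurent A m) (F : ilaurent A n -> ilaurent A m) :
  ucont F -> ucont (fun f => c * F f).
Proof. exact: (ucont_comp (ucont_mul c)). Qed.

Lemma ucont_mulr n m (c : ilaurent A m) (F : ilaurent A n -> ilaurent A m) :
  ucont F -> ucont (fun f => F f * c).
Proof.
move=> Fc lam; have [mu muP] := ucont_mull c Fc lam.
by exists mu => f /muP; rewrite mulrC.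
Qed.

(** The working form of [density]: each single coefficient of the difference vanishes on a basic
    neighborhood. *)
Lemma ucont_eq n m (F G : ilaurent A n -> ilaurent A m) :
  {morph F : f g / f + g} -> {morph G : f g / f + g} -> ucont F -> ucont G ->
  (forall a k, F (mono a k) = G (mono a k)) -> forall f, F f = G f.
Proof.
move=> FD GD Fc Gc FG f; apply: icoef_inj => l.
have [lam lamP] := inU_icoef A l.
have [mu muP] := Fc lam; have [nu nuP] := Gc lam.
have [ka [k1 k2]] := Zset_directed mu nu.
apply/eqP; rewrite -subr_eq0; apply/eqP.
apply: (density (F := fun f => icoef (F f) l - icoef (G f) l) (lam := ka)).
- by move=> g h /=; rewrite FD GD !icoefD; ring.
- move=> g gU /=; rewrite !lamP ?subrr//; first exact/nuP/(inU_sub k2).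
  exact/muP/(inU_sub k1).
- by move=> a k; rewrite FG subrr.
Qed.

End Continuity.
Arguments ucont_dop {A n} c.
Arguments ucont_id {A} n.


Section HasseSchmidt.
Variables (A : comPzRingType) (n : nat).
Local Notation R := (ilaurent A n).
Implicit Types (f g h : R) (H : nat -> R -> R).

(** A higher derivation: f -> sum_s H_s(f) T^s is a ring homomorphism into power series that reduces
    to the identity at T = 0, linear over A and continuous in each order. *)
Record HS H : Prop := {
  HS0 : forall f, H 0%N f = f;
  HSD : forall s, {morph H s : f g / f + g};
  HSZ : forall s a f, H s (mono a 0 * f) = mono a 0 * H s f;
  HSM : forall s f g, H s (f * g) = \sum_(i < s.+1) H i f * H (s - i)%N g;
  HSc : forall s, ucont (H s) }.

(** t_j^s times the divided s-th derivative in t_j, that is, the coefficients of the substitution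
    t_j -> t_j (1 + T); order 1 is t_j d/dt_j. The factor t_j^s keeps the operators diagonal on
    monomials. *)
Definition hasse (j : 'I_n) (s : nat) : R -> R := dop (fun k => binz (k j) s).

(** Both sides of the product rule are additive and continuous in each factor, so it reduces to
    monomials, where it is Vandermonde's identity. *)
Lemma HS_hasse j : HS (hasse j).
Proof.
split=> [f|s f g|s a f|s f g|s].
- by apply: icoef_inj => k; rewrite icoef_dop binz0 mulr1z.
- exact: dopD.
- by apply: icoef_inj => k; rewrite icoef_dop !icoef_mono0M icoef_dop mulrzAr.
- move: f; apply: (ucont_eq (F := fun f => hasse j s (f * g))
    (G := fun f => \sum_(i < s.+1) hasse j i f * hasse j (s - i) g)) => [f f'|f f'|||a k].
  + by rewrite mulrDl /hasse dopD.
  + by rewrite -big_split; apply: eq_bigr => i _; rewrite /hasse /= dopD mulrDl.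
  + exact: (ucont_comp (ucont_dop _) (ucont_mulr g (ucont_id n))).
  + apply: (ucont_sum _ (F := fun (i : 'I_s.+1) f => hasse j i f * hasse j (s - i) g)) => i.
    exact: (ucont_mulr _ (ucont_dop _)).
  move: g; apply: (ucont_eq (F := fun g => hasse j s (mono a k * g))
    (G := fun g => \sum_(i < s.+1) hasse j i (mono a k) * hasse j (s - i) g)) =>
    [f f'|f f'|||b l].
  + by rewrite mulrDr /hasse dopD.
  + by rewrite -big_split; apply: eq_bigr => i _; rewrite /hasse /= dopD mulrDr.
  + exact: (ucont_comp (ucont_dop _) (ucont_mul _)).
  + apply: (ucont_sum _ (F := fun (i : 'I_s.+1) g => hasse j i (mono a k) * hasse j (s - i) g)) => i.
    exact: (ucont_mull _ (ucont_dop _)).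
  rewrite monoM /hasse dop_mono -[(k + l) j]/(k j + l j) binz_vandermonde.
  have -> : (a * b) *~ (\sum_(i < s.+1) binz (k j) i * binz (l j) (s - i)) =
      \sum_(i < s.+1) (a *~ binz (k j) i) * (b *~ binz (l j) (s - i)).
    rewrite mulrz_sumr; apply: eq_bigr => i _.
    by rewrite mulrzAl mulrzAr -mulrzA (mulrC (binz (k j) i)).
  rewrite (big_morph (fun c => mono c (k + l)) (fun c d => monoD c d (k + l)) (mono0 A (k + l))).
  by apply: eq_bigr => i _; rewrite !dop_mono monoM.
- exact: ucont_dop.
Qed.

(** The substitution T -> v T. *)
Lemma HS_scale v H : HS H -> HS (fun s f => v ^+ s * H s f).
Proof.
move=> HH; split=> [f|s f g|s a f|s f g|s].
- by rewrite mul1r (HS0 HH).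
- by rewrite (HSD HH) mulrDr.
- by rewrite (HSZ HH) mulrCA.
- rewrite (HSM HH) mulr_sumr; apply: eq_bigr => i _.
  have -> : v ^+ s = v ^+ i * v ^+ (s - i) by rewrite -exprD subnKC// -ltnS.
  ring.
- exact/ucont_mull/(HSc HH).
Qed.

(** A full square with a test puts all summation indices in one type, so that nested convolutions
    can be exchanged freely. *)
Lemma conv_sum (V : zmodType) (N s : nat) (G : nat -> nat -> V) : (s < N)%N ->
  \sum_(i < s.+1) G i (s - i)%N =
  \sum_(a < N) \sum_(b < N) if (a + b == s)%N then G a b else 0.
Proof.
move=> sN; rewrite (big_ord_widen N (fun i => G i (s - i)%N))// big_mkcond /=.
apply: eq_bigr => a _; rewrite -big_mkcond /=; case: ltnP => [|sa].
  rewrite ltnS => aS; have sa : (s - a < N)%N by lia.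
  rewrite (big_pred1 (Ordinal sa)) //= => b; apply/eqP/eqP => [E|->/=]; last by lia.
  by apply: val_inj => /=; lia.
by rewrite big_pred0// => b; apply/eqP; lia.
Qed.

Lemma conv_nest (V : zmodType) (N s t : nat) (G : nat -> nat -> V) : (s < N)%N ->
  \sum_(b < N) (if (b + t == s)%N then
     \sum_(c < N) \sum_(d < N) (if (c + d == b)%N then G c d else 0) else 0) =
  \sum_(c < N) \sum_(d < N) if (c + d + t == s)%N then G c d else 0.
Proof.
move=> sN.
transitivity (\sum_(b < N) \sum_(c < N) \sum_(d < N)
    if (b + t == s)%N && (c + d == b)%N then G c d else 0).
  apply: eq_bigr => b _; case: eqP => //= _.
  by rewrite big1 // => c _; rewrite big1.
rewrite exchange_big; apply: eq_bigr => c _; rewrite exchange_big.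
apply: eq_bigr => d _; rewrite -big_mkcond /=; case: eqP => [E|E].
  have cd : (c + d < N)%N by lia.
  rewrite (big_pred1 (Ordinal cd)) //= => b; apply/andP/eqP => [[_ /eqP e]|->/=].
    by apply: val_inj => /=.
  by rewrite E.
by rewrite big_pred0// => b; apply/negP => /andP[/eqP e1 /eqP e2]; lia.
Qed.

(** These are the coefficients of the composite of the two homomorphisms into power series. Both
    sides of the product rule become the sum of H_p(K_c f) H_q(K_d g) over p + q + c + d = s. *)
Lemma HS_comp H K : HS H -> HS K ->
  HS (fun s f => \sum_(i < s.+1) H i (K (s - i)%N f)).
Proof.
move=> HH HK; split=> [f|s f g|s a f|s f g|s].
- by rewrite big_ord1 (HS0 HH) (HS0 HK).
- by rewrite -big_split; apply: eq_bigr => i _; rewrite (HSD HK) (HSD HH).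
- by rewrite mulr_sumr; apply: eq_bigr => i _; rewrite (HSZ HK) (HSZ HH).
- have H00 i : H i 0 = 0 by apply: (addrI (H i 0)); rewrite -(HSD HH) !addr0.
  pose N := s.+1; have sN : (s < N)%N by [].
  rewrite (conv_sum (fun a b => H a (K b (f * g))) sN).
  transitivity (\sum_(b < N) \sum_(a < N) (if (b + a == s)%N then
     \sum_(p < N) \sum_(q < N) (if (p + q == a)%N then
       \sum_(c < N) \sum_(d < N) if (c + d == b)%N then
        H p (K c f) * H q (K d g) else 0 else 0) else 0)).
    rewrite exchange_big; apply: eq_bigr => b _; apply: eq_bigr => a _.
    rewrite addnC; case: eqP => // _.
    rewrite (HSM HK) (conv_sum (fun c d => K c f * K d g) (ltn_ord b)).
    rewrite (big_morph (H a) (HSD HH a) (H00 a)).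
    transitivity (\sum_(c < N) \sum_(d < N) \sum_(p < N) \sum_(q < N)
       if (p + q == a)%N && (c + d == b)%N then H p (K c f) * H q (K d g) else 0).
      apply: eq_bigr => c _; rewrite (big_morph (H a) (HSD HH a) (H00 a)).
      apply: eq_bigr => d _; case: (c + d == b)%N; last first.
        by rewrite H00 big1// => p _; rewrite big1// => q _; rewrite andbF.
      rewrite (HSM HH) (conv_sum (fun p q => H p (K c f) * H q (K d g)) (ltn_ord a)).
      by apply: eq_bigr => p _; apply: eq_bigr => q _; rewrite andbT.
    have ex (F : 'I_N -> 'I_N -> 'I_N -> 'I_N -> R) :
       \sum_(c < N) \sum_(d < N) \sum_(p < N) \sum_(q < N) F c d p q =
       \sum_(p < N) \sum_(q < N) \sum_(c < N) \sum_(d < N) F c d p q.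
      transitivity (\sum_(c < N) \sum_(p < N) \sum_(q < N) \sum_(d < N) F c d p q).
        apply: eq_bigr => c _; rewrite exchange_big; apply: eq_bigr => p _.
        exact: exchange_big.
      rewrite exchange_big; apply: eq_bigr => p _; exact: exchange_big.
    rewrite ex; apply: eq_bigr => p _; apply: eq_bigr => q _; case: eqP => //= _.
    by rewrite big1// => c _; rewrite big1.
  transitivity (\sum_(p < N) \sum_(q < N) \sum_(c < N) \sum_(d < N)
     if (c + d + (p + q) == s)%N then H p (K c f) * H q (K d g) else 0).
    transitivity (\sum_(b < N) \sum_(p < N) \sum_(q < N)
      (if (p + q + b == s)%N then \sum_(c < N) \sum_(d < N)
         (if (c + d == b)%N then H p (K c f) * H q (K d g) else 0) else 0)).
      apply: eq_bigr => b _; rewrite -(conv_nest _ (fun p q => \sum_(c < N) \sum_(d < N)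
         (if (c + d == b)%N then H p (K c f) * H q (K d g) else 0)) sN).
      by apply: eq_bigr => a _; rewrite addnC.
    rewrite exchange_big; apply: eq_bigr => p _; rewrite exchange_big.
    apply: eq_bigr => q _.
    rewrite -(conv_nest _ (fun c d => H p (K c f) * H q (K d g)) sN).
    by apply: eq_bigr => b _; rewrite [in LHS]addnC.
  rewrite (conv_sum (fun u w => (\sum_(i < u.+1) H i (K (u - i)%N f)) *
    (\sum_(i < w.+1) H i (K (w - i)%N g))) sN).
  transitivity (\sum_(p < N) \sum_(c < N) \sum_(q < N) \sum_(d < N)
     if (q + d + (p + c) == s)%N then H p (K c f) * H q (K d g) else 0).
    apply: eq_bigr => p _; rewrite exchange_big; apply: eq_bigr => c _.
    apply: eq_bigr => q _; apply: eq_bigr => d _; congr (if _ then _ else _).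
    by apply/eqP/eqP; lia.
  transitivity (\sum_(w < N) \sum_(p < N) \sum_(c < N)
      (if (p + c + w == s)%N then \sum_(q < N) \sum_(d < N)
         (if (q + d == w)%N then H p (K c f) * H q (K d g) else 0) else 0)).
    rewrite [in RHS]exchange_big; apply: eq_bigr => p _; rewrite [in RHS]exchange_big.
    apply: eq_bigr => c _.
    rewrite -(conv_nest _ (fun q d => H p (K c f) * H q (K d g)) sN).
    by apply: eq_bigr => b _; rewrite [in LHS]addnC.
  rewrite [in RHS]exchange_big; apply: eq_bigr => w _.
  have -> : \sum_(i < w.+1) H i (K (w - i)%N g) =
     \sum_(q < N) \sum_(d < N) if (q + d == w)%N then H q (K d g) else 0.
    exact: (conv_sum (fun q d => H q (K d g)) (ltn_ord w)).
  rewrite -(conv_nest _ (fun p c => \sum_(q < N) \sum_(d < N)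
         (if (q + d == w)%N then H p (K c f) * H q (K d g) else 0)) sN).
  apply: eq_bigr => u _; case: eqP => // _.
  rewrite (conv_sum (fun p c => H p (K c f)) (ltn_ord u)) mulr_suml.
  apply: eq_bigr => p _; rewrite mulr_suml; apply: eq_bigr => c _.
  case: eqP => [_|_]; last by rewrite mul0r.
  rewrite mulr_sumr; apply: eq_bigr => q _; rewrite mulr_sumr.
  by apply: eq_bigr => d _; case: eqP => // _; rewrite mulr0.
- apply: (ucont_sum _ (F := fun (i : 'I_s.+1) f => H i (K (s - i)%N f))) => i.
  exact: (ucont_comp (HSc HH _) (HSc HK _)).
Qed.

End HasseSchmidt.
Arguments HS_hasse {A n} j.

Section Nilpotent.
Variable R : comPzRingType.
Implicit Types x y : R.

Lemma nilpotentM x y : nilpotent x -> nilpotent (x * y).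
Proof. by move=> [k xk]; exists k; rewrite exprMn xk mul0r. Qed.

Lemma nilpotent0 : nilpotent (0 : R).
Proof. by exists 1%N; rewrite expr1. Qed.

Lemma nilpotentD x y : nilpotent x -> nilpotent y -> nilpotent (x + y).
Proof.
move=> [k xk] [l yl]; exists (k + l)%N; rewrite exprDn big1 // => i _.
have [il|li] := leqP l i.
  by rewrite -(subnKC il) exprD yl mul0r mulr0 mul0rn.
have ki : (k <= k + l - i)%N by lia.
by rewrite -(subnKC ki) exprD xk !mul0r mul0rn.
Qed.

Lemma nilpotentN x : nilpotent x -> nilpotent (- x).
Proof. by rewrite -mulrN1; exact: nilpotentM. Qed.

Lemma nilpotentX x k : nilpotent (x ^+ k) -> nilpotent x.
Proof. by move=> [l xl]; exists (k * l)%N; rewrite exprM. Qed.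

Lemma nilpotent_idem x : nilpotent x -> x * x = x -> x = 0.
Proof.
move=> [k xk] xx; have xS j : x ^+ j.+1 = x by elim: j => // j IH; rewrite exprS IH.
by rewrite -(xS k) exprS xk mulr0.
Qed.

Lemma invertible_addnil x y : invertible x -> nilpotent y -> invertible (x + y).
Proof.
move=> [z xz] yN; have [k yzk] : nilpotent (- (y * z)) by apply/nilpotentN/nilpotentM.
exists (z * \sum_(i < k) (- (y * z)) ^+ i).
rewrite mulrA mulrDl xz.
have := subrX1 (- (y * z)) k; rewrite yzk sub0r => /(congr1 -%R).
by rewrite opprK -mulNr opprB opprK => <-.
Qed.

End Nilpotent.


Section HasseSchmidtApplications.
Variables (A : comPzRingType) (n : nat).
Local Notation R := (ilaurent A n).
Implicit Types (f g h : R) (H : nat -> R -> R).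

(** First-order parts add under composition, so composing rescaled coordinate families realizes any
    such vector field; an exponential would divide by factorials. *)
Lemma HS_flow (I : finType) (p : I -> 'I_n) (v : I -> R) :
  exists2 H, HS H & forall f, H 1%N f = \sum_i v i * hasse (p i) 1 f.
Proof.
elim: index_enum => [|i r [H HH H1]].
  exists (fun s f => if s == 0%N then f else 0) => [|f]; last by rewrite big_nil.
  split=> [//|s f g|s a f|s f g|[|s]].
  - by case: eqP; rewrite ?addr0.
  - by case: eqP; rewrite ?mulr0.
  - rewrite big_ord_recl big1 => [|j _]; last by rewrite mul0r.
    by rewrite /= subn0 addr0; case: eqP => //; rewrite mulr0.
  - exact: ucont_id.
  - exact: ucont_zero.
exists (fun s f => \sum_(j < s.+1) v i ^+ j * hasse (p i) j (H (s - j)%N f)) => [|f].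
  exact: (HS_comp (HS_scale (v i) (HS_hasse (p i))) HH).
rewrite big_cons -H1 big_ord_recl big_ord1 /= (HS0 HH) expr1 addrC.
by rewrite mul1r subn0 (HS0 (HS_hasse _)).
Qed.

Lemma HS_zero H : HS H -> forall s, H s 0 = 0.
Proof. by move=> HH s; apply: (addrI (H s 0)); rewrite -(HSD HH) !addr0. Qed.

Definition hser_fun H f (i : int) : R := if i is Posz s then H s f else 0.

Lemma hserP H f : hser_fun H f \in @laurent_pred R.
Proof. by apply/laurent_predP; exists 0 => -[]. Qed.

(** The generating series sum_s H_s(f) T^s, housed in [laurent] to reuse its product. *)
Definition hser H f : laurent R := Laurent (hserP H f).

Lemma hserM H : HS H -> {morph hser H : f g / f * g}.
Proof.
move=> HH f g; apply: laurent_eq => -[s|s]; last first.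
  by rewrite (@lcoefM_lt _ _ _ 0 0)// => -[].
rewrite (@lcoefM _ _ _ 0 0 _ s.+1)//; [|by case|by case|by lia].
rewrite /= (HSM HH); apply: eq_bigr => i _; rewrite add0r /=; congr (_ * _).
by have -> : (s%:Z - i%:Z)%R = (s - i)%N by have := ltn_ord i; lia.
Qed.

(** Once the lower positive orders vanish, differentiating e^2 = e gives (1 - 2 e) H_s(e) = 0, and 1
    - 2 e is its own inverse. *)
Lemma HS_idem H e : HS H -> e * e = e -> forall s, H s.+1 e = 0.
Proof.
move=> HH ee s; elim/ltn_ind: s => s IH.
have E : H s.+1 e = e * H s.+1 e + H s.+1 e * e.
  rewrite -{1}ee (HSM HH) big_ord_recl big_ord_recr /= subn0 subnn (HS0 HH).
  rewrite big1 ?add0r// => i _; rewrite /bump add1n IH ?mul0r//.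
have u : (1 - e *+ 2) * (1 - e *+ 2) = 1.
  have -> : (1 - e *+ 2) * (1 - e *+ 2) = 1 + 4%:R * (e * e - e) by ring.
  by rewrite ee subrr mulr0 addr0.
rewrite -[LHS]mul1r -u -mulrA.
have -> : (1 - e *+ 2) * H s.+1 e = H s.+1 e - (e * H s.+1 e + H s.+1 e * e) by ring.
by rewrite -E subrr mulr0.
Qed.

(** By [HS_idem] the coefficient at [k] is killed by all binomials of k_j of positive order, and
    these generate the unit ideal of Z when k_j is nonzero. *)
Lemma idem_const (e : R) : e * e = e -> e = mono (icoef e 0) (0 : mindex n).
Proof.
move=> ee; apply: icoef_inj => k; rewrite icoef_mono; case: eqP => [->//|k0].
have ek j s : icoef e k *~ binz (k j) s.+1 = 0.
  by have := congr1 (fun f => icoef f k) (HS_idem (HS_hasse j) ee s);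
     rewrite /= icoef_dop (icoef0 A).
have [j kj] : exists j, k j <> 0.
  by apply: contra_notP k0 => k0; apply/funext => j; apply: contra_notP k0 => kj; exists j.
case E : (k j) => [a|a].
  have := ek j a.-1; rewrite E prednK; last by lia.
  by rewrite /= binn.
(* For k_j = -(a+1), Vandermonde's identity for k_j + (a+1) = 0 writes 1 as a combination of the
   binomials of positive order. *)
have := congr1 (fun c => icoef e k *~ c) (binz_vandermonde (k j) a.+1%:Z a.+1).
rewrite [in X in X = _ -> _]E NegzE addNr binz0n /= mulr0z.
rewrite big_ord_recl /= !binz0 mul1r subn0 binn mulrzDr mulr1z mulrz_sumr.
by rewrite big1 ?addr0// => i _; rewrite mulrzA ek mul0rz.
Qed.

(** A mere derivation can fail this: d/dx sends the nilpotent x of F_p[x]/(x^p) to 1. Here g^N = 0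
    gives H_N(g^N) = 0, which puts H_1(g)^N in the ideal of g. *)
Lemma HS1_nilpotent H g : HS H -> nilpotent g -> nilpotent (H 1%N g).
Proof.
move=> HH.
pose dvd x := exists z, x = g * z.
have dvd_sum (r : seq nat) (F : nat -> R) : (forall i, i \in r -> dvd (F i)) ->
    dvd (\sum_(i <- r) F i).
  move=> Fr; rewrite big_seq; elim/big_ind : _ => [|x y [w ->] [w' ->]|//].
    by exists 0; rewrite mulr0.
  by exists (w + w'); rewrite mulrDr.
(* Modulo g, H_N(g^N) is H_1(g)^N. *)
have claim N : (forall s, (s < N)%N -> dvd (H s (g ^+ N))) /\
    exists z, H N (g ^+ N) = H 1%N g ^+ N + g * z.
  elim: N => [|N [IH1 [z IH2]]].
    by split => //; exists 0; rewrite (HS0 HH) mulr0 addr0.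
  have rest s m : (s <= N.+1)%N -> (s - N < m)%N ->
      dvd (\sum_(m <= i < s.+1) H i g * H (s - i)%N (g ^+ N)).
    move=> sN sm; apply: dvd_sum => i; rewrite mem_index_iota => /andP[mi si].
    have [|w ->] := IH1 (s - i)%N; first by lia.
    by exists (H i g * w); rewrite mulrCA.
  split=> [s sN|].
    rewrite exprS (HSM HH) -(big_mkord xpredT (fun i => H i g * H (s - i)%N (g ^+ N))).
    rewrite big_ltn// (HS0 HH).
    have [||w ->] := rest s 1%N; [by lia|by lia|].
    by exists (H (s - 0)%N (g ^+ N) + w); rewrite mulrDr.
  rewrite exprS (HSM HH) -(big_mkord xpredT (fun i => H i g * H (N.+1 - i)%N (g ^+ N))).
  rewrite big_ltn// big_ltn// (HS0 HH) subSS !subn0 IH2.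
  have [||w ->] := rest N.+1 2%N; [by lia|by lia|].
  by exists (H N.+1 (g ^+ N) + H 1%N g * z + w); rewrite [in RHS]exprS; ring.
move=> [N gN]; have [_ [z]] := claim N; rewrite gN (HS_zero HH).
move=> /eqP; rewrite eq_sym addr_eq0 => /eqP E.
by apply: (nilpotentX (k := N)); rewrite E -mulrN; apply: nilpotentM; exists N.
Qed.

End HasseSchmidtApplications.

(** * Invertible series *)

Section LaurentUnits.
Variable B : comPzRingType.
Implicit Types x y : laurent B.

Lemma lcoefX_lead x (N : int) : (forall i, i < N -> lcoef x i = 0) ->
  forall k, (forall i, i < N *+ k -> lcoef (x ^+ k) i = 0) /\
    lcoef (x ^+ k) (N *+ k) = lcoef x N ^+ k.
Proof.
move=> xN; elim=> [|k [IH1 IH2]].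
  by split=> // i i0; rewrite lcoef1 lt_eqF.
rewrite !exprS mulrS; split; first exact: (lcoefM_lt xN IH1).
by rewrite (lcoefM_lead xN IH1) IH2.
Qed.

(** The lowest coefficient of x^k is the k-th power of that of x; it is peeled off, and the next one
    is treated in the same way. *)
Lemma lcoef_nilpotent x : nilpotent x -> forall i, nilpotent (lcoef x i).
Proof.
move=> xn i; have [N xN] := lcoef_bounded x.
have [iN|Ni] := ltP i N; first by rewrite xN//; exact: nilpotent0.
have -> : i = N + `|i - N|%N%:Z by lia.
move: `|i - N|%N => d {i Ni}; elim: d x N xn xN => [|d IH] x N xn xN.
  rewrite addr0; have [k xk] := xn; exists k.
  by have [_ <-] := lcoefX_lead xN k; rewrite xk.
have xNn : nilpotent (lcoef x N).
  have [k xk] := xn; exists k.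
  by have [_ <-] := lcoefX_lead xN k; rewrite xk.
have -> : lcoef x (N + d.+1%:Z) = lcoef (x - lmon N (lcoef x N)) (N + 1 + d%:Z).
  have -> : N + d.+1%:Z = N + 1 + d%:Z by lia.
  by rewrite lcoefB lcoef_lmon ifF ?subr0//; apply/eqP; lia.
apply: IH => [|i iN]; first exact/nilpotentD/nilpotentN/lmon_nilpotent.
rewrite lcoefB lcoef_lmon; case: eqP => [->|iN']; first exact: subrr.
by rewrite xN ?subr0//; lia.
Qed.

(* With u = x_N, a power u^d kills the coefficients y_j for j < - N, so that
   u^d = u^d u y_(- N). *)
Lemma unit_lead_idempotent x y (N : int) : x * y = 1 ->
  (forall i, i < N -> lcoef x i = 0) ->
  exists M z, let e := lcoef x N * z in e * e = e /\ lcoef x N ^+ M = lcoef x N ^+ M * e.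
Proof.
move=> xy xN; set u := lcoef x N; have [J yJ] := lcoef_bounded y.
have xmon d : x * (lmon 0 (u ^+ d) * y) = lmon 0 (u ^+ d) by rewrite mulrCA xy mulr1.
(* The lowest coefficient that u^d leaves below [- N] is killed by one more factor u: their product
   is the coefficient of a constant at a negative exponent. *)
have ykill d : forall j, j < J + d%:Z -> j < - N -> u ^+ d * lcoef y j = 0.
  elim: d => [|d IH] j jd jN; first by rewrite yJ ?mulr0//; lia.
  have [jJ|jJ] := ltP j (J + d%:Z); first by rewrite exprS -mulrA IH ?mulr0.
  have y0 : forall i, i < j -> lcoef (lmon 0 (u ^+ d) * y) i = 0.
    by move=> i ij; rewrite lcoef_lmonM subr0 IH//; lia.
  have := lcoefM_lead xN y0; rewrite xmon lcoef_lmonM subr0 lcoef_lmon ifF.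
    by rewrite exprS mulrA => <-.
  by apply/eqP; lia.
pose d := `|(- N - J)%R|%N.
have y0 : forall i, i < - N -> lcoef (lmon 0 (u ^+ d) * y) i = 0.
  by move=> i iN; rewrite lcoef_lmonM subr0 ykill//; lia.
pose c := u * lcoef y (- N).
have uc : u ^+ d * c = u ^+ d.
  have := lcoefM_lead xN y0.
  rewrite xmon subrr lcoef_lmonM subr0 lcoef_lmon eqxx => {2}->.
  by rewrite /c -/u; ring.
have uck k : u ^+ d * c ^+ k = u ^+ d.
  by elim: k => [|k IH]; rewrite ?mulr1// exprS mulrA uc.
have ucS k : u ^+ d.+1 * c ^+ k = u ^+ d.+1 by rewrite exprS -mulrA uck.
(* Multiplication by c fixes u^d only; c^(d+1) contains the factor u^(d+1), which absorbs powers of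
   c, and is therefore idempotent. *)
exists d.+1, (u ^+ d * lcoef y (- N) ^+ d.+1) => /=.
have -> : u * (u ^+ d * lcoef y (- N) ^+ d.+1) = c ^+ d.+1.
  by rewrite mulrA -exprS -exprMn.
split; last by rewrite ucS.
have cE : c ^+ d.+1 = u ^+ d.+1 * lcoef y (- N) ^+ d.+1 by rewrite exprMn.
by rewrite {1 3}cE mulrAC ucS.
Qed.

End LaurentUnits.

Section Units.
Variable A : comPzRingType.

(** Weaker than nilpotency: infinitely many coefficients can have unbounded nilpotency orders. *)
Definition cnil n (f : ilaurent A n) := forall l, nilpotent (icoef f l).

Lemma cnilS n (f : ilaurent A n.+1) :
  cnil f <-> forall i, cnil (lcoef f i : ilaurent A n).
Proof.
split=> [fn i l|fn l]; last exact: fn.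
by have := fn (mcons i l); rewrite /= mcons_max minit_mcons.
Qed.

Lemma cnilD n (f g : ilaurent A n) : cnil f -> cnil g -> cnil (f + g).
Proof. by move=> fn gn l; rewrite icoefD; apply: nilpotentD. Qed.

Lemma cnil0 n : cnil (0 : ilaurent A n).
Proof. by move=> l; rewrite icoef0; exact: nilpotent0. Qed.

Lemma cnilM n (f g : ilaurent A n) : cnil f -> cnil (f * g).
Proof.
elim: n f g => [|n IH] f g; first by move=> fn l; apply/nilpotentM/(fn 0).
move=> /cnilS fn; apply/cnilS => k.
have [N fN] := lcoef_bounded (f : laurent (iter_laurent A n)).
have [M gM] := lcoef_bounded (g : laurent (iter_laurent A n)).
have -> := @lcoefM _ (f : laurent (iter_laurent A n)) g N M k `|(k - N - M + 1)%R|%N fN gM.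
  elim/big_ind : _ => [|x y|i _]; [exact: cnil0|exact: cnilD|exact: (IH _ _ (fn _))].
by lia.
Qed.

Lemma nilpotent_cnil n (f : ilaurent A n) : nilpotent f -> cnil f.
Proof.
elim: n f => [|n IH] f fn; first by move=> l.
by apply/cnilS => i; apply: IH; exact: (@lcoef_nilpotent (iter_laurent A n) f fn).
Qed.

(** The condition that [is_nu] imposes on one factor of the decomposition. *)
Definition wlead n (l : mindex n) (f : ilaurent A n) :=
  (forall k, lexlt k l -> nilpotent (icoef f k)) /\ invertible (icoef f l).

Lemma wleadE n (l : mindex n) (f : ilaurent A n) : wlead l f ->
  exists p g, [/\ f = p + g, cnil g, suppge l p & invertible (icoef p l)].
Proof.
move=> [fl lf]; pose c k : int := `[< lexlt k l >].
have fE k : icoef (f - dop c f) k = if `[< lexlt k l >] then 0 else icoef f k.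
  by rewrite icoefB icoef_dop /c; case: asboolP => _; rewrite ?subrr ?subr0.
exists (f - dop c f), (dop c f); split.
- by rewrite subrK.
- move=> k; rewrite icoef_dop /c; case: asboolP => [/fl //|_].
  exact: nilpotent0.
- by move=> k kl; rewrite fE asboolT.
- by rewrite fE asboolF// => -[_].
Qed.

Lemma invertibleM (R : comPzRingType) (a b : R) :
  invertible a -> invertible b -> invertible (a * b).
Proof. by move=> [a' aa] [b' bb]; exists (a' * b'); rewrite mulrACA aa bb mulr1. Qed.

Lemma wleadM n (l l' : mindex n) f g : wlead l f -> wlead l' g -> wlead (l + l') (f * g).
Proof.
move=> /wleadE[p [r [-> rn pl lp]]] /wleadE[q [s [-> sn ql lq]]].
have [pq1 pq2] := suppge_mul pl ql.
have rest : cnil (r * (q + s) + s * p) by apply: cnilD; exact: cnilM.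
have -> : (p + r) * (q + s) = p * q + (r * (q + s) + s * p) by ring.
split=> [k kl|]; first by rewrite icoefD pq1// add0r; exact: rest.
by rewrite icoefD; apply: invertible_addnil; [rewrite pq2; exact: invertibleM|exact: rest].
Qed.

Lemma wlead1 n : wlead (0 : mindex n) (1 : ilaurent A n).
Proof.
split=> [k [_ k0]|]; rewrite icoef1; last by exists 1; rewrite eqxx mulr1.
by case: eqP => // _; exact: nilpotent0.
Qed.

Lemma wleadX n (l : mindex n) f k : wlead l f -> wlead (l *+ k) (f ^+ k).
Proof.
move=> fl; elim: k => [|k IH]; first exact: wlead1.
by rewrite exprS mulrS; exact: wleadM.
Qed.

(** The strong form of [wlead]: whatever lies below [l] is absorbed by a nilpotent series. *)
Definition splits n (l : mindex n) (f : ilaurent A n) :=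
  exists p g, [/\ f = p + g, nilpotent g, suppge l p & invertible (icoef p l)].

(** The outer coefficients below the last coordinate of [l] turn out to be nilpotent and are removed
    one at a time; the one at that coordinate is then a unit, to which the induction on [n]
    applies. *)
Lemma unit_splits n (l : mindex n) (x : ilaurent A n) :
  invertible x -> wlead l x -> splits l x.
Proof.
elim: n l x => [|n IH] l x.
  move=> _ [_ xl]; exists x, 0; split=> //; first by rewrite addr0.
    exact: nilpotent0.
  by move=> k [_ []]; exact: mindex0.
pose e := l ord_max.
have claim d : forall x : laurent (iter_laurent A n), invertible x ->
    wlead l (x : ilaurent A n.+1) ->
    (forall i, i < e - d%:Z -> lcoef x i = 0) -> splits l (x : ilaurent A n.+1).
  elim: d => [|d IHd] {}x [y xy] xl xd.
    rewrite subr0 in xd.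
    (* A power of [u] is fixed by the constant idempotent [a] and has an invertible coefficient, so
       [a] is 1 and [u] is a unit. *)
    have [M [z /= []]] := unit_lead_idempotent xy xd.
    set u : ilaurent A n := lcoef x e => /(@idem_const A n); set a := icoef _ _ => za uz.
    have ul : wlead (minit l) u.
      case: xl => xk xl; split=> // k kl; have := xk (mcons e k).
      rewrite /= mcons_max minit_mcons; apply.
      by apply/lexltS; right; rewrite mcons_max minit_mcons.
    have [_ [b ub]] := wleadX M ul.
    have a1 : a = 1.
      have := congr1 (fun f : ilaurent A n => icoef f (minit l *+ M)) uz.
      rewrite za mulrC icoef_mono0M => /(congr1 (fun f => f * b)).
      by rewrite -mulrA ub mulr1.
    have uinv : invertible u by exists z; rewrite za a1 mono1.
    have [p [g [upg gn pl lp]]] := IH _ _ uinv ul.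
    pose q := lmon e (p : iter_laurent A n) + (x - lmon e (u : iter_laurent A n)).
    have qe : lcoef q e = p by rewrite lcoefD lcoefB !lcoef_lmon eqxx subrr addr0.
    exists q.
    exists (lmon e (g : iter_laurent A n)); split.
    + by rewrite /q upg lmonD; ring.
    + exact: lmon_nilpotent.
    + apply/suppgeS; split=> [i ie|].
        by rewrite lcoefD lcoefB !lcoef_lmon lt_eqF// xd// subr0 addr0.
      by rewrite [lcoef _ _]qe.
    + by move: lp; rewrite -{1}qe.
  pose i0 := e - d.+1%:Z; set u : ilaurent A n := lcoef x i0.
  have un : cnil u.
    move=> k; have := xl.1 (mcons i0 k); rewrite /= mcons_max minit_mcons; apply.
    by apply/lexltS; left; rewrite mcons_max /i0 -/e; lia.
  (* Here the idempotent has nilpotent coefficients, so it is 0 and a power of [u] vanishes. *)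
  have [M [z /= [ee]]] := unit_lead_idempotent xy xd; rewrite -/i0 -/u in ee *.
  have := idem_const ee; set a := icoef _ _ => za uz.
  have a0 : a = 0.
    apply: nilpotent_idem; first exact: (cnilM z un).
    have := congr1 (fun f : ilaurent A n => icoef f 0) ee.
    by rewrite za icoef_mono0M !icoef_mono eqxx.
  have unil : nilpotent u by exists M; rewrite uz za a0 mono0 mulr0.
  have [x' x'def] : exists x', x' = x - lmon i0 (u : iter_laurent A n) by eexists.
  have x'E i : lcoef x' i = if i == i0 then 0 else lcoef x i.
    rewrite x'def lcoefB lcoef_lmon; case: eqP => [->|_]; first exact: subrr.
    exact: subr0.
  have xu : splits l (x' : ilaurent A n.+1).
    apply: IHd.
    - rewrite x'def; apply: invertible_addnil; first by exists y.
      exact/nilpotentN/lmon_nilpotent.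
    - split=> [k kl|]; rewrite /= x'E.
        case: eqP => _; first by rewrite (icoef0 A); exact: nilpotent0.
        exact: (xl.1 _ kl).
      by rewrite ifF; [exact: xl.2|apply/eqP; rewrite /i0 -/e; lia].
    - move=> i id; rewrite x'E; case: eqP => // ii.
      by rewrite xd//; rewrite /i0 in ii; lia.
  have [p [g [E gn pl lp]]] := xu.
  exists p, (g + lmon i0 (u : iter_laurent A n)); split=> //.
    by rewrite addrA -E x'def subrK.
  exact/nilpotentD/lmon_nilpotent.
move=> xinv xl; have [N xN] := lcoef_bounded (x : laurent (iter_laurent A n)).
by apply: (claim `|(e - N)%R|%N) => // i ie; apply: xN; lia.
Qed.

End Units.

(** * Valuations and constant terms up to nilpotents *)

Section Splits.
Variables (A : comPzRingType) (n : nat).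
Local Notation R := (ilaurent A n).
Implicit Types (f g h x z : R) (k l : mindex n) (a b e : A).

Lemma splitsM l l' x x' : splits l x -> splits l' x' -> splits (l + l') (x * x').
Proof.
move=> [p [g [-> gn pl lp]]] [q [h [-> hn ql lq]]].
have [pq1 pq2] := suppge_mul pl ql.
exists (p * q), (g * (q + h) + h * p); split.
- by ring.
- by apply: nilpotentD; exact: nilpotentM.
- exact: pq1.
- by rewrite pq2; exact: invertibleM.
Qed.

Lemma splits1 : splits 0 (1 : R).
Proof.
exists 1, 0; split; [by rewrite addr0|exact: nilpotent0| |].
  by move=> k [_ k0]; rewrite icoef1; case: eqP.
by rewrite icoef1 eqxx; exists 1; rewrite mulr1.
Qed.

Lemma splitsX l x (k : nat) : splits l x -> splits (l *+ k) (x ^+ k).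
Proof.
move=> xl; elim: k => [|k IH]; first exact: splits1.
by rewrite exprS mulrS; exact: splitsM.
Qed.

Lemma splits_invertible l x : splits l x -> invertible (icoef x l).
Proof.
move=> [p [g [-> gn pl lp]]]; rewrite icoefD; apply: invertible_addnil => //.
exact: nilpotent_cnil.
Qed.

(** The lowest terms of [p] and [q] have a nonzero product, which must be the only term of 1. *)
Lemma suppge_inv l (p q : R) : suppge l p -> invertible (icoef p l) -> p * q = 1 ->
  suppge (- l) q /\ icoef p l * icoef q (- l) = 1.
Proof.
move=> pl [b pb] pq.
have ql : suppge (- l) q.
  have [->|/eqP q0] := eqVneq q 0; first by move=> k _; exact: icoef0.
  have [k qk kq] := lexmin q0.
  have [_] := suppge_mul pl kq; rewrite pq icoef1; case: eqP => [E _|_ /esym E].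
    by have <- : k = - l by apply: (addrI l); rewrite E subrr.
  by case: qk; rewrite -[LHS]mul1r -pb mulrAC E mul0r.
split=> //; have [_] := suppge_mul pl ql.
by rewrite pq subrr icoef1 eqxx.
Qed.

(** As [p * z = 1 - g * z] is a unit, [p] is invertible, and its inverse differs from [z] by a
    multiple of the nilpotent [g]. *)
Lemma splits_inverse l x z : splits l x -> x * z = 1 ->
  exists p q, [/\ suppge l p, suppge (- l) q, icoef p l * icoef q (- l) = 1,
    nilpotent (x - p) & nilpotent (z - q)].
Proof.
move=> [p [g [xE gn pl lp]]] xz.
have [b gb] : invertible (1 - g * z).
  by apply: invertible_addnil; [exists 1; rewrite mulr1|apply/nilpotentN/nilpotentM].
have pz : p * z = 1 - g * z by rewrite -xz xE; ring.
have pq : p * (z * b) = 1 by rewrite mulrA pz.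
have [ql pqE] := suppge_inv pl lp pq.
exists p, (z * b); split=> //; first by rewrite xE addrAC subrr add0r.
have -> : z - z * b = g * (z * (- z * b)) + z * (1 - (1 - g * z) * b) by ring.
by rewrite gb subrr mulr0 addr0; exact: nilpotentM.
Qed.

Lemma splits_inv l x z : splits l x -> x * z = 1 -> splits (- l) z.
Proof.
move=> xl xz; have [p [q [_ ql pq _ zq]]] := splits_inverse xl xz.
exists q, (z - q); split=> //; first by rewrite addrC subrK.
by exists (icoef p l); rewrite mulrC.
Qed.

(** A relation, because [a] is determined only up to nilpotents. It is compatible with ring
    operations, hence with determinants. *)
Definition cterm f a :=
  exists p g, [/\ f = p + g, nilpotent g, suppge 0 p & icoef p 0 = a].

Lemma ctermD f f' a a' : cterm f a -> cterm f' a' -> cterm (f + f') (a + a').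
Proof.
move=> [p [g [-> gn pl <-]]] [q [h [-> hn ql <-]]].
exists (p + q), (g + h); split; [by ring|exact: nilpotentD|exact: suppgeD|exact: icoefD].
Qed.

Lemma ctermM f f' a a' : cterm f a -> cterm f' a' -> cterm (f * f') (a * a').
Proof.
move=> [p [g [-> gn pl <-]]] [q [h [-> hn ql <-]]].
have := suppge_mul pl ql; rewrite addr0 => -[pq1 pq2].
exists (p * q), (g * (q + h) + h * p); split=> //; first by ring.
by apply: nilpotentD; exact: nilpotentM.
Qed.

Lemma cterm_mono a : cterm (mono a 0) a.
Proof.
exists (mono a 0), 0; split; [by rewrite addr0|exact: nilpotent0| |].
  by move=> k [_ k0]; rewrite icoef_mono; case: eqP.
by rewrite icoef_mono eqxx.
Qed.

Lemma cterm0 : cterm 0 0.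
Proof. by have := cterm_mono 0; rewrite mono0. Qed.

Lemma cterm1 : cterm 1 1.
Proof. by have := cterm_mono 1; rewrite mono1. Qed.

Lemma ctermN f a : cterm f a -> cterm (- f) (- a).
Proof.
move=> [p [g [-> gn pl <-]]]; exists (- p), (- g).
by split; [rewrite opprD|exact: nilpotentN|exact: suppgeN|exact: icoefN].
Qed.

Lemma cterm_det m (M : 'M[R]_m) (a : 'M[A]_m) :
  (forall i j, cterm (M i j) (a i j)) -> cterm (\det M) (\det a).
Proof.
move=> Ma; apply: (big_ind2 cterm cterm0) => [*|s _]; first exact: ctermD.
apply: ctermM; first by case: (perm.odd_perm s); rewrite ?expr0 ?expr1; [apply/ctermN/cterm1|exact: cterm1].
by apply: (big_ind2 cterm cterm1) => [*|i _]; [exact: ctermM|exact: Ma].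
Qed.

(** A lowest term a t^l of x contributes l_j a t^l to t_j dx/dt_j, so the quotient by x starts with
    l_j; nilpotent parts stay nilpotent by [HS1_nilpotent]. *)
Lemma cterm_logder l x z j : splits l x -> x * z = 1 ->
  cterm (z * hasse j 1 x) ((l j)%:~R).
Proof.
move=> xl xz; have [p [q [pl ql pq xp zq]]] := splits_inverse xl xz.
have hp : suppge l (hasse j 1 p) by exact: suppge_dop.
have := suppge_mul ql hp; rewrite addNr => -[qp1 qp2].
have hx : hasse j 1 x = hasse j 1 (x - p) + hasse j 1 p.
  by rewrite -(HSD (HS_hasse j)) subrK.
exists (q * hasse j 1 p), ((z - q) * hasse j 1 x + hasse j 1 (x - p) * q); split=> //.
- by rewrite hx; ring.
- apply: nilpotentD; first exact: nilpotentM.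
  exact/nilpotentM/(HS1_nilpotent (HS_hasse j)).
- by rewrite qp2 icoef_dop binz1 mulrzAr mulrC pq.
Qed.

(** Comparing lowest terms makes [p] regular on the component of [e]. The nilpotent part is removed
    by p h = - g h, whence p^N h = (- g)^N h = 0. *)
Lemma cterm_regular f a e : e * e = e -> (forall b, a * b = 0 -> e * b = 0) ->
  cterm f a -> forall h, f * h = 0 -> mono e 0 * h = 0.
Proof.
move=> ee ae [p [g [-> [N gN] pl pa]]].
have preg h : p * h = 0 -> mono e 0 * h = 0.
  move=> ph; apply: contrapT => /lexmin[k hk kh].
  have [_] := suppge_mul pl kh.
  rewrite mulrCA ph mulr0 icoef0 pa => /esym /ae.
  by rewrite icoef_mono0M mulrA ee -icoef_mono0M.
have pX M h : p ^+ M * h = 0 -> mono e 0 * h = 0.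
  elim: M h => [|M IH] h; first by rewrite mul1r => ->; rewrite mulr0.
  rewrite exprS -mulrA => /preg; rewrite mulrCA => /IH.
  by rewrite mulrA monoM ee addr0.
move=> h ph; apply: (pX N).
have phE : p * h = - g * h by apply/eqP; rewrite -subr_eq0 mulNr opprK -mulrDl ph.
have -> : p ^+ N * h = (- g) ^+ N * h.
  elim: N {gN} => // N IH; rewrite exprSr -mulrA phE mulrCA IH [in RHS]exprS; ring.
by rewrite exprNn gN mulr0 mul0r.
Qed.

End Splits.

(** * Neighborhoods that force increasing pivots *)

Section Echelon.
Variable A : comPzRingType.

Fixpoint Lconst n (c : int) : Lam n :=
  if n is n'.+1 return Lam n then (fun=> Lconst n' c, c) else tt.

Lemma ZsetLconst n c (l : mindex n) : (forall j, c <= l j) -> Zset (Lconst n c) l.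
Proof. by elim: n l => [//|n IH] l lc; split=> //; apply: IH => j; exact: lc. Qed.

(* Below the topmost nonzero coordinate c the bound is quadratic in c: it then
   admits all b u - a v with a large compared to b, however b was chosen. *)
Fixpoint Lquad n : Lam n :=
  if n is n'.+1 return Lam n then
    (fun c => if c == 0 then Lquad n' else Lconst n' (- (c * c)), 0)
  else tt.

Lemma ZsetLquad n (p : 'I_n) (l : mindex n) : 0 < l p ->
  (forall j : 'I_n, (p < j)%N -> l j = 0) ->
  (forall j : 'I_n, (j < p)%N -> - (l p * l p) <= l j) -> Zset (Lquad n) l.
Proof.
elim: n p l => [|n IH] p l; first by case: p.
move=> lp l0 lq /=; case: (unliftP ord_max p) => [p' pE|pE].
  have -> : l ord_max = 0 by apply: l0; rewrite pE lift_max ltn_ord.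
  split=> //; rewrite eqxx; apply: (IH p') => [|j pj|j jp].
  - by rewrite /minit -pE.
  - by apply: l0; rewrite pE !lift_max.
  - by rewrite /minit -pE; apply: lq; rewrite pE !lift_max.
rewrite -pE; split; first exact: ltW.
rewrite gt_eqF//; apply: ZsetLconst => j.
by apply: lq; rewrite pE lift_max ltn_ord.
Qed.

(** The exponents of the variables preceding the [i]-th are unrestricted, even if very negative: a
    large power of the [i]-th variable alone makes the monomial small. *)
Lemma mono_inU n (mu : Lam n) (i : 'I_n) : exists b : nat, forall k : mindex n,
  k i = b%:Z -> (forall j : 'I_n, (i < j)%N -> k j = 0) -> inU mu (mono (1 : A) k).
Proof.
suff [b bP] : exists b : nat, forall k : mindex n,
    k i = b%:Z -> (forall j : 'I_n, (i < j)%N -> k j = 0) -> ~ Zset mu (- k).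
  exists b => k ki k0 l lZ; rewrite icoef_mono; case: eqP => // lk.
  by case: (bP k ki k0); rewrite -lk opprK.
elim: n mu i => [|n IH] mu i; first by case: i.
case: (unliftP ord_max i) => [i' ->|->].
  have [b bP] := IH (mu.1 0) i'; exists b => k ki k0 [_].
  have kmax : k ord_max = 0 by apply: k0; rewrite lift_max ltn_ord.
  rewrite opprfctE kmax oppr0; apply: (bP (minit k)) => // j ij.
  by apply: k0; rewrite !lift_max.
exists `|mu.2|.+1 => k ki _ [+ _]; rewrite opprfctE ki; lia.
Qed.

End Echelon.

(** * Taylor expansion along a homomorphism *)

Lemma mbase_diag n (k : mindex n) (i j : 'I_n) : (k + mbase i) j = k j + (i == j)%:Z.
Proof. by []. Qed.

Lemma mindex_ind n (P : mindex n -> Prop) : P 0 ->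
  (forall k i, P k <-> P (k + mbase i)) -> forall k, P k.
Proof.
move=> P0 PS.
suff H (r : seq 'I_n) : uniq r -> forall k : mindex n, (forall j, j \notin r -> k j = 0) -> P k.
  by move=> k; apply: (H (enum 'I_n) (enum_uniq _)) => j; rewrite mem_enum.
elim: r => [|i r IH] /=.
  move=> _ k k0; suff -> : k = 0 by [].
  by apply/funext => j; exact: k0.
move=> /andP[ir ru].
have claim (c : int) : forall k : mindex n, k i = c ->
    (forall j, j \notin i :: r -> k j = 0) -> P k.
  move: c; apply: int_ind2 => [k ki k0|c].
    apply: (IH ru) => j jr; have [->//|ji] := eqVneq j i.
    by apply: k0; rewrite inE negb_or ji.
  split=> H k ki k0.
    have -> : k = (k - mbase i) + mbase i by rewrite subrK.
    apply: (PS _ i).1; apply: H => [|j jr]; first by rewrite -[LHS]/(k i - (i == i)%:Z) ki eqxx; lia.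
    rewrite -[LHS]/(k j - (i == j)%:Z) k0// eq_sym.
    by move: jr; rewrite inE => /norP[/negbTE ->].
  apply: (PS _ i).2; apply: H => [|j jr]; first by rewrite mbase_diag ki eqxx.
  rewrite mbase_diag k0// eq_sym.
  by move: jr; rewrite inE => /norP[/negbTE ->].
by move=> k k0; exact: (claim (k i)).
Qed.

Lemma monoMz (A : comPzRingType) n (a : A) (c : int) (k : mindex n) :
  mono (a *~ c) k = mono a k *~ c.
Proof.
have S b s : mono (b *+ s) k = mono b k *+ s.
  by elim: s => [|s IH]; rewrite ?mono0// !mulrS monoD IH.
have N b : mono (- b) k = - mono b k.
  by apply/eqP; rewrite eq_sym -subr_eq0 -opprD oppr_eq0 -monoD subrr mono0.
by case: c => s; rewrite -?pmulrn ?NegzE ?mulrNz -?pmulrn ?N S.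
Qed.

Section SeriesCongruence.
Variables (B : comPzRingType) (r : nat).
Implicit Types f g h : laurent B.

Definition nonneg f := forall i, i < 0 -> lcoef f i = 0.

Lemma nonnegM f g : nonneg f -> nonneg g ->
  nonneg (f * g) /\ lcoef (f * g) 0 = lcoef f 0 * lcoef g 0.
Proof.
move=> f0 g0; split; first exact: (lcoefM_lt f0 g0).
exact: (lcoefM_lead f0 g0).
Qed.

Lemma nonneg_prod (I : Type) (s : seq I) (P : pred I) (F : I -> laurent B) :
  (forall i, P i -> nonneg (F i)) -> nonneg (\prod_(i <- s | P i) F i) /\
  lcoef (\prod_(i <- s | P i) F i) 0 = \prod_(i <- s | P i) lcoef (F i) 0.
Proof.
move=> F0; elim/big_ind2 : _ => [|f a g b [f0 <-] [g0 <-]|i Pi].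
- by split=> // i i0; rewrite lcoef1 lt_eqF.
- exact: nonnegM.
- by split=> //; exact: F0.
Qed.

Definition scong f g := forall i, i <= r%:Z -> lcoef f i = lcoef g i.

Lemma scong_mull h f g : nonneg h -> scong f g -> scong (h * f) (h * g).
Proof.
move=> h0 fg i ir; apply/eqP; rewrite -subr_eq0 -lcoefB -mulrBr; apply/eqP.
apply: (lcoefM_lt h0 (M := r%:Z + 1)); last by lia.
by move=> j jr; rewrite lcoefB fg ?subrr//; lia.
Qed.

Lemma scong_trans f g h : scong f g -> scong g h -> scong f h.
Proof. by move=> fg gh i ir; rewrite fg// gh. Qed.

Lemma scong_sym f g : scong f g -> scong g f.
Proof. by move=> fg i ir; rewrite fg. Qed.

Lemma lcoefMz f (c : int) i : lcoef (f *~ c) i = lcoef f i *~ c.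
Proof.
have S k : lcoef (f *+ k) i = lcoef f i *+ k.
  by elim: k => // k IH; rewrite !mulrS lcoefD IH.
by case: c => k; rewrite -?pmulrn ?NegzE ?mulrNz -?pmulrn ?lcoefN S.
Qed.

(** The binomial series of (1 + w)^k cut at order r. When w has no constant term it represents the
    power modulo T^(r+1), hence the congruences [scong]. *)
Definition bser (w : laurent B) (k : int) : laurent B :=
  \sum_(s < r.+1) w ^+ s *~ binz k s.

Lemma bserS w k : (forall i, i < 1 -> lcoef w i = 0) ->
  scong (bser w (k + 1)) ((1 + w) * bser w k).
Proof.
move=> w1.
suff E : (1 + w) * bser w k = bser w (k + 1) + w ^+ r.+1 *~ binz k r.
  move=> i ir; rewrite E lcoefD lcoefMz.
  have [wr _] := lcoefX_lead w1 r.+1.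
  by rewrite wr ?mul0rz ?addr0// natz; lia.
rewrite mulrDl mul1r {2}/bser mulr_sumr big_ord_recr /= mulrzAr -exprS addrA.
congr (_ + _); rewrite /bser !big_ord_recl !binz0 -addrA; congr (_ + _).
rewrite -big_split; apply: eq_bigr => s _.
by rewrite /= binzS mulrzDr mulrzAr -exprS.
Qed.

Lemma bser0 w : bser w 0 = 1.
Proof.
by rewrite /bser big_ord_recl binz0 mulr1z expr0 big1 ?addr0.
Qed.

Lemma nonnegX w k : nonneg w -> nonneg (w ^+ k).
Proof.
move=> w0; elim: k => [|k IH]; first by move=> i i0; rewrite lcoef1 lt_eqF.
by rewrite exprS; have [] := nonnegM w0 IH.
Qed.

Lemma nonneg_bser w k : nonneg w -> nonneg (bser w k).
Proof.
move=> w0; rewrite /bser; elim/big_ind : _ => [//|f g f0 g0 i i0|s _ i i0].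
  by rewrite lcoefD f0// g0// addr0.
by rewrite lcoefMz nonnegX// mul0rz.
Qed.

End SeriesCongruence.

Section Hom.
Variables (A : comPzRingType) (n m : nat) (phi : {rmorphism ilaurent A n -> ilaurent A m}).
Hypothesis phi_mono0 : forall a, phi (mono a 0) = mono a 0.
Hypothesis phi_ucont : ucont phi.
Local Notation R := (ilaurent A m).

Let X (k : mindex n) : R := phi (mono 1 k).

Lemma hom_monoD k l : X (k + l) = X k * X l.
Proof. by rewrite /X -rmorphM monoM mulr1. Qed.

Lemma hom_mono0 : X 0 = 1.
Proof. by rewrite /X mono1 rmorph1. Qed.

Lemma hom_monoN k : X k * X (- k) = 1.
Proof. by rewrite -hom_monoD subrr hom_mono0. Qed.

Lemma hom_mono a k : phi (mono a k) = mono a 0 * X k.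
Proof. by rewrite -phi_mono0 /X -rmorphM monoM mulr1 add0r. Qed.

Section Flow.
Variables (S : nat -> R -> R) (SH : HS S) (r : nat).

Let C : R -> laurent R := @laurentC R.

Let CM a b : C (a * b) = C a * C b.
Proof.
apply: laurent_eq => i; rewrite /C.
have -> : laurentC a = lmon 0 a by apply: laurent_eq.
by rewrite lcoef_lmonM subr0 /= /const_fun; case: eqP; rewrite ?mulr0.
Qed.

Let lcoefCM a (f : laurent R) i : lcoef (C a * f) i = a * lcoef f i.
Proof.
have -> : C a = lmon 0 a by apply: laurent_eq.
by rewrite lcoef_lmonM subr0.
Qed.

(** The generating series of X(k) divided by X(k): multiplicative in [k] with constant term 1, so
    that [k] enters only through exponents. *)
Let U k : laurent R := C (X (- k)) * hser S (X k).

Let w i : laurent R := U (mbase i) - 1.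

Let U_lcoef k (s : nat) : lcoef (U k) s = X (- k) * S s (X k).
Proof. exact: lcoefCM. Qed.

Let U_nonneg k : nonneg (U k).
Proof. by case=> // i _; rewrite lcoefCM mulr0. Qed.

Let UD k l : U (k + l) = U k * U l.
Proof. by rewrite /U opprD !hom_monoD hserM// CM mulrACA. Qed.

Let U0 : U 0 = 1.
Proof.
apply: laurent_eq => -[s|s]; last by rewrite U_nonneg.
rewrite U_lcoef oppr0 hom_mono0 mul1r lcoef1; case: s => [|s]; first exact: HS0.
exact: HS_idem (mulr1 _) _.
Qed.

Let w_small i j : j < 1 -> lcoef (w i) j = 0.
Proof.
move=> j1; rewrite lcoefB lcoef1; have [->|j0] := eqVneq j 0.
  by rewrite U_lcoef (HS0 SH) mulrC hom_monoN subrr.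
by rewrite U_nonneg ?subr0//; lia.
Qed.

Let Z k : laurent R := \prod_i bser r (w i) (k i).

Let UZ k : scong r (U k) (Z k).
Proof.
have w0 i : nonneg (w i) by move=> j j0; apply: w_small; lia.
have Z0 l : nonneg (Z l).
  by have [] := @nonneg_prod R _ (index_enum _) xpredT (fun i => bser r (w i) (l i))
    (fun i _ => @nonneg_bser _ r _ (l i) (w0 i)).
move: k; apply: mindex_ind => [|k i].
  by rewrite U0 /Z big1// => i _; rewrite bser0.
have ZS : scong r (Z (k + mbase i)) (U (mbase i) * Z k).
  rewrite /Z (bigD1 i)//= [in X in scong _ _ X](bigD1 i)//= mulrA.
  rewrite mbase_diag eqxx.
  rewrite (eq_bigr (fun j => bser r (w j) (k j))) => [|j ji]; last first.
    by rewrite mbase_diag eq_sym (negbTE ji) addr0.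
  rewrite mulrC [X in scong _ _ X]mulrC; apply: scong_mull.
    by have [] := @nonneg_prod R _ (index_enum _) (fun j => j != i)
      (fun j => bser r (w j) (k j)) (fun j _ => @nonneg_bser _ r _ (k j) (w0 j)).
  have -> : U (mbase i) = 1 + w i by rewrite addrC subrK.
  by apply: bserS => j; exact: w_small.
rewrite UD mulrC; split=> UZk.
  apply: scong_trans (scong_mull (@U_nonneg _) UZk) (scong_sym ZS).
have -> : U k = U (- mbase i) * (U (mbase i) * U k).
  by rewrite mulrA -UD addNr U0 mul1r.
have -> : Z k = U (- mbase i) * (U (mbase i) * Z k).
  by rewrite mulrA -UD addNr U0 mul1r.
apply: scong_mull (@U_nonneg _) _; exact: scong_trans UZk ZS.
Qed.

Let J := {ffun 'I_n -> 'I_r.+1}.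

Definition bprod (s : 'I_n -> nat) (k : mindex n) : int := \prod_i binz (k i) (s i).

Let c (j : J) : R := lcoef (\prod_i w i ^+ j i) r.

Let Z_lcoef k : lcoef (Z k) r = \sum_(j : J) c j *~ bprod (fun i => j i) k.
Proof.
rewrite /Z /bser bigA_distr_bigA /=.
have lsum (I : finType) (F : I -> laurent R) : lcoef (\sum_i F i) r = \sum_i lcoef (F i) r.
  by apply: (big_morph (fun f : laurent R => lcoef f r)).
rewrite lsum; apply: eq_bigr => j _; rewrite /c -lcoefMz; congr lcoef.
rewrite /bprod; elim/big_rec3 : _ => [|i x y z _ ->]; first by rewrite mulr1z.
by rewrite mulrzAl mulrzAr -mulrzA; congr (_ *~ _); exact: mulrC.
Qed.

(** S_r(X(k)) is X(k) times the coefficient of T^r in the product of the (1 + w_i)^(k_i): a sum of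
    products of binomials in [k] whose coefficients do not depend on [k]. Powers of w_i beyond r do
    not contribute, as w_i starts in order 1. *)
Lemma taylor f : S r (phi f) = \sum_(j : J) c j * phi (dop (bprod (fun i => j i)) f).
Proof.
move: f; apply: ucont_eq => [f g|f g|||a k].
- by rewrite rmorphD (HSD SH).
- by rewrite -big_split; apply: eq_bigr => j _; rewrite /= dopD rmorphD mulrDr.
- exact: (ucont_comp (HSc SH r) phi_ucont).
- apply: (ucont_sum _ (F := fun (j : J) f => c j * phi (dop (bprod (fun i => j i)) f))) => j.
  exact: (ucont_mull _ (ucont_comp phi_ucont (ucont_dop _))).
rewrite hom_mono (HSZ SH).
have -> : S r (X k) = X k * lcoef (U k) r by rewrite U_lcoef mulrA hom_monoN mul1r.
rewrite (UZ k (lexx _)) Z_lcoef mulrA mulr_sumr; apply: eq_bigr => j _.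
rewrite dop_mono hom_mono.
rewrite monoMz mulrzAl [RHS]mulrzAr mulrzAr.
by congr (_ *~ _); ring.
Qed.

Lemma flow_step (i0 : 'I_n) (D : R) f : (0 < r)%N ->
  (forall i, X (- mbase i) * S 1 (X (mbase i)) = if i == i0 then D else 0) ->
  (forall s : 'I_n -> nat, (forall i, (s i < r)%N) -> phi (dop (bprod s) f) = 0) ->
  phi f = 0 -> D ^+ r * phi (hasse i0 r f) = 0.
Proof.
move=> r0 SX flow f0.
have w0 i : nonneg (w i) by move=> j j0; apply: w_small; lia.
have w1 i : lcoef (w i) 1 = if i == i0 then D else 0.
  by rewrite lcoefB lcoef1 subr0 U_lcoef SX.
pose jmax : J := [ffun i => if i == i0 then ord_max else ord0].
have Bmax : dop (bprod (fun i => jmax i)) f = hasse i0 r f.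
  congr dop; apply/funext => k; rewrite /bprod (bigD1 i0)//= ffunE eqxx.
  by rewrite big1 ?mulr1// => i ii; rewrite ffunE (negbTE ii) binz0.
(* [w i ^+ r] already starts in order r, so only lowest coefficients contribute. *)
have cE (j : J) i : j i = ord_max ->
    c j = lcoef (w i) 1 ^+ r * \prod_(i' | i' != i) lcoef (w i' ^+ j i') 0.
  move=> ji; rewrite /c (bigD1 i)//= ji.
  have [wr wrE] := lcoefX_lead (@w_small i) r.
  have [p0 pE] := @nonneg_prod R _ (index_enum _) (fun i' => i' != i) (fun i' => w i' ^+ j i')
    (fun i' _ => nonnegX _ (w0 i')).
  have := lcoefM_lead wr p0; rewrite addr0 wrE pE.
  by have -> : 1 *+ r = r%:Z by rewrite -mulr_natl mulr1 natz.
(* A multi-index with a component equal to r has order > r unless it is jmax. *)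
have := taylor f; rewrite f0 (HS_zero SH) (bigD1 jmax)//= Bmax (cE _ i0); last by rewrite ffunE eqxx.
rewrite w1 eqxx [\prod_(_ | _) _]big1 => [|i ii]; last first.
  by rewrite ffunE (negbTE ii) expr0.
rewrite mulr1 big1 ?addr0// => j jmax'.
have [/existsP[i /eqP ji]|/existsPn jr] := boolP [exists i, j i == ord_max]; last first.
  rewrite flow ?mulr0// => i; rewrite ltn_neqAle -ltnS ltn_ord andbT.
  by apply: contra (jr i) => /eqP ji; apply/eqP/val_inj.
rewrite (cE _ i)// w1; case: eqP => [ii|_]; last by rewrite expr0n gtn_eqF// !mul0r.
have [i' i'i ji'] : exists2 i', i' != i & j i' != ord0.
  apply: contraNP jmax' => H; apply/eqP/ffunP => i'; rewrite ffunE.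
  case: eqP => [->|/eqP i'i]; first by rewrite -ii.
  by apply/eqP; apply: contra_notT H => ?; exists i'; rewrite // ii.
rewrite (bigD1 i')//=.
have := @nonnegX _ (w i') (j i').-1 (w0 i').
have ji'0 : (0 < j i')%N by rewrite lt0n; apply: contra ji' => /eqP e; apply/eqP/val_inj.
move=> /(nonnegM (w0 i'))[_]; rewrite -exprS prednK// => ->.
by rewrite w_small// !mul0r mulr0 mul0r.
Qed.

End Flow.
End Hom.

(** * Components of the spectrum *)

Lemma mulrn_mindex n (k : mindex n) (s : nat) j : (k *+ s) j = k j *+ s.
Proof. by elim: s => // s IH; rewrite !mulrS -IH. Qed.

Lemma mindex_combE n (u v : mindex n) (a b : nat) j :
  (u *+ b - v *+ a) j = u j * b%:Z - v j * a%:Z.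
Proof.
rewrite -[LHS]/((u *+ b) j - (v *+ a) j) (mulrn_mindex u) (mulrn_mindex v).
by rewrite !pmulrn !mulrzz.
Qed.

Lemma echelon_bound (b N : nat) (u v u' v' : int) :
  0 < u -> (`|v| <= N)%N -> (`|u'| <= N)%N -> (`|v'| <= N)%N ->
  let a := (b * N + N * b * N + b * N + N + 1)%N in
  let c := u * a%:Z - v * b%:Z in 0 < c /\ - (c * c) <= u' * a%:Z - v' * b%:Z.
Proof.
move=> u0 vN u'N v'N a c.
pose t : int := N%:Z * b%:Z * N%:Z + b%:Z * N%:Z + N%:Z + 1.
have aE : a%:Z = b%:Z * N%:Z + t by rewrite /t /a !PoszD !PoszM; ring.
have le1 (w : int) (s : nat) : (`|w| <= N)%N -> - (N%:Z * s%:Z) <= w * s%:Z <= N%:Z * s%:Z.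
  by move=> wN; rewrite -mulNr !ler_wpM2r//; lia.
have bN0 : 0 <= b%:Z * N%:Z by [].
have NbN0 : 0 <= N%:Z * b%:Z * N%:Z by [].
have t0 : 0 < t by rewrite /t; lia.
have ct : t <= c.
  have /andP[_ h1] := le1 v b vN.
  have h2 : a%:Z <= u * a%:Z by rewrite -[leLHS]mul1r ler_wpM2r.
  by rewrite /c; lia.
split; first exact: lt_le_trans ct.
have /andP[_ h1] := le1 v' b v'N.
have /andP[h2 _] := le1 u' a u'N.
have h3 : (N%:Z + 1) * t <= t * t.
  by apply: ler_wpM2r; [exact: ltW|rewrite /t; lia].
have h4 : t * t <= c * c by apply: ler_pM => //; exact: ltW.
have h5 : N%:Z * a%:Z + N%:Z * b%:Z <= (N%:Z + 1) * t by rewrite aE /t; lia.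
by lia.
Qed.

Section Component.
Variables (A : comPzRingType) (n m : nat) (phi : {rmorphism ilaurent A n -> ilaurent A m}).
Hypothesis phi_mono0 : forall a, phi (mono a 0) = mono a 0.
Hypothesis phi_ucont : ucont phi.
Local Notation R := (ilaurent A m).
Local Notation X := (fun k => phi (mono 1 k)).

Variables (e : A) (l : 'I_n -> mindex m).
Hypothesis ee : e * e = e.
Hypothesis low : forall i k, lexlt k (l i) -> nilpotent (e * icoef (X (mbase i)) k).
Hypothesis lead_unit : forall i, exists b, e * icoef (X (mbase i)) (l i) * b = e.

Let E : R := mono e 0.
Let EE : E * E = E. Proof. by rewrite /E monoM ee addr0. Qed.

(* Off the component of e, phi(t_i) is replaced by the monomial t^(l i): the result
   is a unit of L^m(A) with the constant valuation l i, so A needs no base change. *)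
Let x i : R := E * X (mbase i) + mono (1 - e) (l i).
Let z i : R := E * X (- mbase i) + mono (1 - e) (- l i).

Let e1e : e * (1 - e) = 0. Proof. by rewrite mulrBr ee mulr1 subrr. Qed.

Let Ex i : E * x i = E * X (mbase i).
Proof. by rewrite mulrDr mulrA EE monoM e1e mono0 addr0. Qed.

Let Ez i : E * z i = E * X (- mbase i).
Proof. by rewrite mulrDr mulrA EE monoM e1e mono0 addr0. Qed.

Let xz i : x i * z i = 1.
Proof.
rewrite /x /z mulrDl !mulrDr.
have -> : E * X (mbase i) * (E * X (- mbase i)) = E.
  by rewrite mulrACA EE (hom_monoN phi) mulr1.
have -> : E * X (mbase i) * mono (1 - e) (- l i) = 0.
  by rewrite mulrAC monoM e1e mono0 mul0r.
have -> : mono (1 - e) (l i) * (E * X (- mbase i)) = 0.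
  by rewrite mulrA monoM mulrC mulrC (mulrC _ e) e1e mono0 mul0r.
rewrite monoM subrr addr0 add0r.
have -> : (1 - e) * (1 - e) = 1 - e by rewrite mulrBl mul1r e1e subr0.
by rewrite -monoD addrC subrK mono1.
Qed.

Let x_splits i : splits (l i) (x i).
Proof.
apply: unit_splits; first by exists (z i).
have xE k : icoef (x i) k = e * icoef (X (mbase i)) k + if k == l i then 1 - e else 0.
  by rewrite icoefD icoef_mono0M icoef_mono.
split=> [k kl|]; rewrite xE.
  rewrite ifF ?addr0; first exact: low.
  by apply/eqP => kE; case: kl.
rewrite eqxx; have [b eb] := lead_unit i; exists (e * b + (1 - e)).
set a := icoef _ _ in eb *.
have -> : (e * a + (1 - e)) * (e * b + (1 - e)) =
    e * (e * a * b) + (1 - e) * (1 - e) + (a + b) * (e * (1 - e)) by ring.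
by rewrite e1e eb ee mulr0 addr0 mulrBl mul1r e1e subr0 addrC subrK.
Qed.

Let invertible_e u : invertible u -> e * u = 0 -> e = 0.
Proof. by move=> [v uv] eu; rewrite -[e]mulr1 -uv mulrA eu mul0r. Qed.

(** If the pivots of i < i' were not increasing, t_i'^b t_i^(-a) would be small for large b and
    every a, while for large a the leading exponent of its image lies where [Lquad] demands a zero
    coefficient. On the component of [e] that coefficient is a unit. *)
Lemma echelon (p : 'I_n -> 'I_m) : e <> 0 -> (forall i, 0 < l i (p i)) ->
  (forall i (j : 'I_m), (p i < j)%N -> l i j = 0) ->
  forall i i' : 'I_n, (i < i')%N -> (p i < p i')%N.
Proof.
move=> e0 lp l0 i i' ii'; rewrite ltnNge; apply/negP => pp; apply: e0.
have [mu muP] := phi_ucont (Lquad m).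
have [b bP] := mono_inU A mu i'.
pose N : nat := \max_(j < m) (`|l i j| + `|l i' j|)%N.
have lN j : (`|l i j| + `|l i' j| <= N)%N.
  exact: (leq_bigmax (F := fun j => (`|l i j| + `|l i' j|)%N)).
(* Chosen after [b], as [echelon_bound] requires. *)
pose a := (b * N + N * b * N + b * N + N + 1)%N.
pose k : mindex n := mbase i' *+ b - mbase i *+ a.
pose kap : mindex m := l i' *+ b - l i *+ a.
have kE j : k j = (i' == j)%:Z * b%:Z - (i == j)%:Z * a%:Z by exact: mindex_combE.
have kapE j : kap j = l i' j * b%:Z - l i j * a%:Z by exact: mindex_combE.
have Xk : X k = X (mbase i') ^+ b * X (- mbase i) ^+ a.
  have Xn u s : X (u *+ s) = X u ^+ s.
    elim: s => [|s IH]; first exact: hom_mono0.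
    by rewrite mulrS (hom_monoD phi) IH exprS.
  by rewrite /k (hom_monoD phi) -mulNrn !Xn.
have : inU (Lquad m) (X k).
  apply: muP; apply: bP => [|j ij]; rewrite kE.
    have ni : (i == i') = false by apply/eqP => iE; rewrite iE ltnn in ii'.
    by rewrite eqxx ni mul1r mul0r subr0.
  have ni : (i == j) = false by apply/eqP => iE; rewrite iE ltnNge (ltnW ij) in ii'.
  have ni' : (i' == j) = false by apply/eqP => iE; rewrite iE ltnn in ij.
  by rewrite ni ni' !mul0r subr0.
move=> /(_ (- kap)); rewrite opprK => kap0.
have XE : E * X k = E * (x i' ^+ b * z i ^+ a).
  have XnE u v s : E * u = E * v -> E * u ^+ s = E * v ^+ s.
    move=> uv; elim: s => // s IH.
    by rewrite !exprS -EE mulrACA uv IH -mulrACA.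
  have ex : E * X (mbase i') ^+ b = E * x i' ^+ b by apply: XnE; rewrite Ex.
  have ez : E * X (- mbase i) ^+ a = E * z i ^+ a by apply: XnE; rewrite Ez.
  by rewrite Xk -EE mulrACA ex ez -mulrACA.
have xz_splits : splits kap (x i' ^+ b * z i ^+ a).
  rewrite /kap -mulNrn; apply: splitsM; apply: splitsX; first exact: x_splits.
  exact: splits_inv (x_splits i) (xz i).
apply: (invertible_e (splits_invertible xz_splits)).
rewrite -icoef_mono0M -/E -XE icoef_mono0M kap0 ?mulr0//.
have lpi := lp i; have lNp := lN (p i).
pose c := l i (p i) * a%:Z - l i' (p i) * b%:Z.
apply: (@ZsetLquad _ (p i)) => [|j pj|j jp]; rewrite !opprfctE !kapE !opprB -?/c.
- by have [] := @echelon_bound b N (l i (p i)) (l i' (p i)) 0 0 ltac:(by []) ltac:(lia) ltac:(lia) ltac:(lia).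
- by rewrite !l0// ?mul0r ?subrr//; exact: leq_ltn_trans pj.
- have lNj := lN j.
  by have [] := @echelon_bound b N (l i (p i)) (l i' (p i)) (l i j) (l i' j) ltac:(by [])
    ltac:(lia) ltac:(lia) ltac:(lia).
Qed.

Variables (p : 'I_n -> 'I_m) (d : A).
Hypothesis p_lt : forall i i' : 'I_n, (i < i')%N -> (p i < p i')%N.
Hypothesis l0 : forall i (j : 'I_m), (p i < j)%N -> l i j = 0.
Hypothesis ed : e * d = e * (\prod_i l i (p i))%:~R.
Hypothesis d_reg : forall b, d * b = 0 -> b = 0.

Let M : 'M[R]_n := \matrix_(i, i') (z i * hasse (p i') 1 (x i)).

(** The matrix of constant terms is triangular because l_i vanishes beyond its pivot and the pivots
    increase; its diagonal consists of the leading entries. *)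
Let M_cterm : cterm (\det M) (\prod_i l i (p i))%:~R.
Proof.
pose a : 'M[A]_n := \matrix_(i, i') (l i (p i'))%:~R.
have -> : (\prod_i l i (p i))%:~R = \det a.
  rewrite det_trig.
    by rewrite (big_morph (intr : int -> A) (rmorphM _) (rmorph1 _)); apply: eq_bigr => i _; rewrite mxE.
  by apply/is_trig_mxP => i i' ii'; rewrite mxE l0//; exact: p_lt.
apply: cterm_det => i i'; rewrite !mxE.
exact: cterm_logder (x_splits i) (xz i).
Qed.

Let M_regular r h : (E * \det M) ^+ r * h = 0 -> E * h = 0.
Proof.
have reg1 g : \det M * g = 0 -> E * g = 0.
  apply: (cterm_regular ee _ M_cterm) => b ab; apply: d_reg.
  by rewrite mulrA (mulrC d) ed -mulrA ab mulr0.
elim: r h => [|r IH] h; first by rewrite mul1r => ->; rewrite mulr0.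
rewrite exprS -!mulrA mulrCA => /reg1; rewrite mulrA EE mulrCA => /IH.
by rewrite mulrA EE.
Qed.

Lemma component_step (i0 : 'I_n) (r : nat) f : (0 < r)%N ->
  (forall s : 'I_n -> nat, (forall i, (s i < r)%N) -> phi (dop (bprod s) f) = 0) ->
  phi f = 0 -> mono e 0 * phi (hasse i0 r f) = 0.
Proof.
move=> r0 flow f0.
(* Column [i0] of the adjugate is sent by [M] to the determinant times the [i0]-th unit vector; the
   factor [E] restricts the field to the component. *)
have [S SH S1] := HS_flow p (fun i' => E * \adj M i' i0).
apply: (M_regular (r := r)); apply: (flow_step phi_mono0 phi_ucont SH) => // i.
have Eh j : E * hasse j 1 (X (mbase i)) = E * hasse j 1 (x i).
  by rewrite -!(HSZ (HS_hasse j)) Ex.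
rewrite S1 mulr_sumr.
transitivity (E * (M *m \adj M) i i0); last first.
  by rewrite mul_mx_adj mxE; case: eqP; rewrite ?mulr1n ?mulr0n ?mulr0.
rewrite mxE mulr_sumr; apply: eq_bigr => i' _; rewrite [M i i']mxE.
transitivity ((E * X (- mbase i)) * (E * hasse (p i') 1 (X (mbase i))) * \adj M i' i0).
  by rewrite mulrACA EE; ring.
by rewrite -Ez Eh mulrACA EE; ring.
Qed.

End Component.

(** * Kernels stable under Hasse derivatives *)

Section DiagonalOperators.
Variables (A : comPzRingType) (n : nat).
Implicit Types (f : ilaurent A n) (c : mindex n -> int).

Lemma dopM c c' f : dop (fun k => c k * c' k) f = dop c (dop c' f).
Proof. by apply: icoef_inj => k; rewrite !icoef_dop mulrC mulrzA. Qed.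

Lemma dop1 f : dop (fun=> 1) f = f.
Proof. by apply: icoef_inj => k; rewrite icoef_dop mulr1z. Qed.

Lemma dop_add c c' f : dop (fun k => c k + c' k) f = dop c f + dop c' f.
Proof. by apply: icoef_inj => k; rewrite icoefD !icoef_dop mulrzDr. Qed.

Lemma dop_mulz (t : int) c f : dop (fun k => t * c k) f = mono t%:~R 0 * dop c f.
Proof.
apply: icoef_inj => k; rewrite icoef_mono0M !icoef_dop mulrC mulrzA.
by rewrite mulrzl.
Qed.

Lemma dop_shift c f u : dop c (mono 1 u * f) = mono 1 u * dop (fun k => c (k + u)) f.
Proof.
move: f; apply: ucont_eq => [f g|f g|||a k].
- by rewrite mulrDr dopD.
- by rewrite /= dopD mulrDr.
- exact: (ucont_comp (ucont_dop _) (ucont_mul _)).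
- exact: (ucont_mull _ (ucont_dop _)).
by rewrite dop_mono !monoM dop_mono !mul1r addrC.
Qed.

(** Modulo a basic neighborhood a series is a finite sum: the outer coordinate is pinned between two
    bounds, and each of the finitely many slices is bounded by induction. *)
Lemma supp_box f (mu : Lam n) :
  exists N : nat, forall l, Zset mu l -> icoef f (- l) <> 0 -> forall j, (`|l j| <= N)%N.
Proof.
elim: n f mu => [|n' IH] f mu; first by exists 0%N => l _ _ [].
have [L fL] := lcoef_bounded (f : laurent (iter_laurent A n')).
have /choice[N NP] : forall i : int, exists N : nat, forall l, Zset (mu.1 i) l ->
    icoef (lcoef f (- i) : ilaurent A n') (- l) <> 0 -> forall j, (`|l j| <= N)%N.
  by move=> i; exact: IH.
pose d := (`|mu.2| + `|L|).+1.
(* The index [s] stands for the outer exponent s - d; this range covers the interval from [mu.2] to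
   [- L]. *)
exists (d + \sum_(s < (d + d)%N) N (s%:Z - d%:Z)%R)%N => l [lmu lZ] fl.
have fl0 : icoef (lcoef f (- l ord_max) : ilaurent A n') (- minit l) <> 0 by exact: fl.
have Ll : L <= - l ord_max.
  rewrite leNgt; apply/negP => lL; case: fl0.
  by rewrite fL// (icoef0 A).
have sd : (`|(l ord_max + d%:Z)%R| < d + d)%N by rewrite /d; lia.
move=> j; case: (unliftP ord_max j) => [j'|] ->; last by rewrite /d; lia.
have := NP _ _ lZ fl0 j'; rewrite /minit => /leq_trans; apply.
rewrite (bigD1 (Ordinal sd))//=.
have -> : (`|(l ord_max + d%:Z)%R|%N%:Z - d%:Z)%R = l ord_max by rewrite /d; lia.
by lia.
Qed.

End DiagonalOperators.

Section Stable.
Variables (A : comPzRingType) (n m : nat) (phi : {rmorphism ilaurent A n -> ilaurent A m}).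
Hypothesis phi_mono0 : forall a, phi (mono a 0) = mono a 0.
Hypothesis phi_ucont : ucont phi.

Definition stable (c : mindex n -> int) := forall f, phi f = 0 -> phi (dop c f) = 0.

Lemma stableM c c' : stable c -> stable c' -> stable (fun k => c k * c' k).
Proof. by move=> cs cs' f f0; rewrite dopM; apply/cs/cs'. Qed.

Lemma stable_prod (I : Type) (r : seq I) (c : I -> mindex n -> int) :
  (forall i, stable (c i)) -> stable (fun k => \prod_(i <- r) c i k).
Proof.
move=> cs; elim: r => [|i r IH] f f0.
  have -> : (fun k => \prod_(i <- [::]) c i k) = (fun=> 1).
    by apply/funext => k; rewrite big_nil.
  by rewrite dop1.
have -> : (fun k => \prod_(j <- i :: r) c j k) = (fun k => c i k * \prod_(j <- r) c j k).
  by apply/funext => k; rewrite big_cons.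
exact: stableM.
Qed.

Lemma stableD c c' : stable c -> stable c' -> stable (fun k => c k + c' k).
Proof. by move=> cs cs' f f0; rewrite dop_add rmorphD cs// cs'// addr0. Qed.

Lemma stable_mulz (t : int) c : stable c -> stable (fun k => t * c k).
Proof. by move=> cs f f0; rewrite dop_mulz rmorphM cs// mulr0. Qed.

(** The kernel is an ideal, so one may multiply by t^u, apply [c], and divide by t^u. *)
Lemma stable_shift u c : stable c -> stable (fun k => c (k + u)).
Proof.
move=> cs f f0; have := cs (mono 1 u * f); rewrite dop_shift !rmorphM f0 mulr0.
move=> /(_ erefl) /(congr1 ( *%R (phi (mono 1 (- u))))).
by rewrite mulr0 mulrA -rmorphM monoM addNr mulr1 mono1 rmorph1 mul1r.
Qed.

Hypothesis binz_stable : forall i s, stable (fun k => binz (k i) s).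

(** Binomials in t + N, shifted so that the nodes start at - N, take the value 1 at each new node;
    interpolation therefore has integer coefficients. *)
Lemma stable_interpolate (i : 'I_n) (N : nat) (tau : int -> int) :
  exists c : int -> int, stable (fun k => c (k i)) /\
    forall t, (`|t| <= N)%N -> c t = tau t.
Proof.
have shift s : stable (fun k => binz (k i + N%:Z) s).
  have := stable_shift (mbase i *~ N%:Z) (binz_stable i s).
  rewrite (_ : (fun k : mindex n => _) = (fun k : mindex n => binz (k i + N%:Z) s))//.
  apply/funext => k; congr binz; congr (_ + _).
  by rewrite -pmulrn mulrn_mindex /mbase eqxx natz.
suff [c [cs cE]] : exists c : int -> int, stable (fun k => c (k i)) /\
    forall s, (s < (N + N).+1)%N -> c (s%:Z - N%:Z) = tau (s%:Z - N%:Z).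
  exists c; split=> // t tN; have := cE `|(t + N%:Z)%R|%N.
  have -> : (`|(t + N%:Z)%R|%N%:Z - N%:Z)%R = t by lia.
  by apply; lia.
elim: (N + N).+1 => [|M [c [cs cE]]].
  exists (fun=> 0); split=> // f f0; have := stable_mulz 0 (shift 0%N) f0.
  by rewrite (_ : (fun k : mindex n => _) = (fun=> 0))//; apply/funext => k; rewrite mul0r.
(* Newton interpolation: the new binomial vanishes at the previous points. *)
pose t := M%:Z - N%:Z.
exists (fun s => c s + (tau t - c t) * binz (s + N%:Z) M); split.
  exact/stableD/stable_mulz/shift.
move=> s; rewrite ltnS leq_eqVlt => /orP[/eqP ->|sM].
  by rewrite subrK /= binn mulr1 addrC subrK.
by rewrite subrK cE//= bin_small// mulr0 addr0.
Qed.

(** A term is isolated for one coefficient of the image at a time: continuity and [supp_box] leave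
    finitely many exponents, on which interpolation provides an indicator of [k]. *)
Lemma stable_kernel f : phi f = 0 -> f = 0.
Proof.
move=> f0; apply: icoef_inj => k; rewrite icoef0.
suff fk0 : phi (mono (icoef f k) k) = 0.
  have := congr1 (fun g => g * phi (mono 1 (- k))) fk0.
  rewrite mul0r -rmorphM monoM mulr1 subrr phi_mono0 => /(congr1 (fun g => icoef g 0)).
  by rewrite icoef_mono eqxx icoef0.
apply: icoef_inj => l; rewrite icoef0.
have [lam lamP] := inU_icoef A l; have [mu muP] := phi_ucont lam.
have [N NP] := supp_box f mu.
(* The box is enlarged to contain [k], where the indicator must be 1. *)
pose N' := (N + \sum_j `|k j|)%N.
have kN' j : (`|k j| <= N')%N by rewrite /N' (bigD1 j)//=; lia.
have /choice[c cP] : forall i, exists c : int -> int, stable (fun k => c (k i)) /\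
    forall t, (`|t| <= N')%N -> c t = (t == k i)%:Z.
  by move=> i; exact: (stable_interpolate i N' (fun t => (t == k i)%:Z)).
pose c' (k' : mindex n) := \prod_i c i (k' i).
have c'0 : phi (dop c' f) = 0.
  by apply: (stable_prod _ (c := fun i k => c i (k i))) => // i; case: (cP i).
have -> : mono (icoef f k) k = dop c' f - (dop c' f - mono (icoef f k) k).
  by rewrite opprB addrC subrK.
rewrite rmorphB c'0 sub0r icoefN lamP ?oppr0//; apply: muP => l' l'Z.
rewrite icoefB icoef_dop icoef_mono.
have c'k : c' k = 1 by rewrite /c' big1// => i _; rewrite (cP i).2// eqxx.
have [->|l'k] := eqVneq (- l') k; first by rewrite c'k mulr1z subrr.
rewrite subr0; have [->|/eqP fl'] := eqVneq (icoef f (- l')) 0; first by rewrite mul0rz.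
have [j ljk] : exists j, (- l') j != k j.
  apply: contrapT => H; move/eqP: l'k; apply; apply/funext => j.
  by apply/eqP/negPn/negP => ljk; apply: H; exists j.
rewrite /c' (bigD1 j)//= (cP j).2 ?(negbTE ljk) ?mul0r ?mulr0z//.
have := NP _ l'Z fl' j; rewrite opprfctE abszN => /leq_trans; apply.
exact: leq_addr.
Qed.

End Stable.

(** * Idempotents, primes and finite decompositions *)

Section Localization.
Variable A : comPzRingType.

(** Properties that hold after a finite decomposition of A, expressed by idempotents of A itself;
    heredity under multiples allows common refinements. *)
Definition local_pred (Q : A -> Prop) :=
  (forall e e', Q e -> Q (e' * e)) /\
  exists I : finType, exists E : I -> A,
    [/\ forall i, E i * E i = E i, forall i, Q (E i) & \sum_i E i = 1].

Lemma local_cover n (I : eqType) (r : seq I) (Q : I -> A -> Prop) (w : ilaurent A n) :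
  (forall i, local_pred (Q i)) ->
  (forall e, e * e = e -> (forall i, i \in r -> Q i e) -> mono e 0 * w = 0) -> w = 0.
Proof.
move=> QL; elim: r => [|i r IH] H.
  by rewrite -[w]mul1r -mono1; apply: H; rewrite ?mul1r.
apply: IH => e ee eQ; have [Qm [J [E [EE EQ E1]]]] := QL i.
have -> : mono e 0 * w = \sum_j mono (e * E j) 0 * w.
  rewrite -mulr_suml; congr (_ * w); rewrite -[in LHS](mulr1 e) -E1 mulr_sumr.
  exact: (big_morph (fun a => mono a 0) (fun a b => monoD a b 0) (mono0 A 0)).
rewrite big1// => j _; apply: H => [|i']; first by rewrite mulrACA ee EE.
rewrite inE => /orP[/eqP ->|i'r]; first exact: Qm.
by rewrite mulrC; apply: (QL i').1; exact: eQ.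
Qed.

Lemma Spec_eq (p q : Spec A) : spec_ideal p = spec_ideal q -> p = q.
Proof.
by case: p q => [p pP] [q qP] /= pq; case: _ / pq qP => qP; congr MkSpec; exact: Prop_irrelevance.
Qed.

(** An ideal maximal among those avoiding [e] is prime: if it contained a b but neither factor, both
    enlargements would contain [e], and so it would contain e e = e. *)
Lemma prime_avoiding (e : A) : e * e = e -> e <> 0 -> exists p : Spec A, ~ spec_ideal p e.
Proof.
move=> ee e0.
pose P (X : set A) := [/\ forall a b, X a -> X b -> X (a + b),
  forall a b, X b -> X (a * b) & ~ X e].
have [F FP Ftot|X [[XD XM Xe] Xmax]] := @Zorn_bigcup A P.
  split=> [a b [Y FY Ya] [Z FZ Zb]|a b [Y FY Yb]|[Y FY Ye]].
  - have [YZ|ZY] := Ftot _ _ FY FZ.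
    + by exists Z => //; have [ZD _ _] := FP _ FZ; apply: ZD => //; exact: YZ.
    + by exists Y => //; have [YD _ _] := FP _ FY; apply: YD => //; exact: ZY.
  - by exists Y => //; have [_ YM _] := FP _ FY; exact: YM.
  - by have [_ _] := FP _ FY; apply.
(* [P] does not ask for 0, so that the empty chain has an upper bound; maximality restores it. *)
have X0 : X 0.
  apply: contrapT => nX0; apply: (Xmax (X `|` [set 0])).
    split=> [a|]; first by left.
    by move=> /(_ 0); apply: (contra_not _ nX0) => H; apply: H; right.
  split=> [a b [Xa|->] [Xb|->]|a b [Xb|->]|[//|]].
  - by left; exact: XD.
  - by left; rewrite addr0.
  - by left; rewrite add0r.
  - by right; rewrite addr0.
  - by left; exact: XM.
  - by right; rewrite mulr0.
  - exact: e0.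
have grow a : ~ X a -> exists x c, X x /\ e = x + a * c.
  move=> Xa; apply: contrapT => H.
  apply: (Xmax [set y | exists x c, X x /\ y = x + a * c]).
    split=> [x Xx|YX]; first by exists x, 0; rewrite mulr0 addr0.
    by apply/Xa/YX; exists 0, 1; rewrite mulr1 add0r.
  split=> [u v [x [c [Xx ->]]] [y [d [Xy ->]]]|u v [x [c [Xx ->]]]|//].
  - exists (x + y), (c + d); split; [exact: XD|ring].
  - exists (u * x), (u * c); split; [exact: XM|ring].
have Xp : prime_ideal X.
  split=> // [X1|a b Xab]; first by apply: Xe; rewrite -[e]mulr1; exact: XM.
  have [Xa|/grow[x [c [Xx ex]]]] := pselect (X a); first by left.
  have [Xb|/grow[y [d [Xy ey]]]] := pselect (X b); first by right.
  case: Xe; rewrite -ee {1}ex ey.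
  have -> : (x + a * c) * (y + b * d) = (y + b * d) * x + ((a * c) * y + (c * d) * (a * b)).
    by ring.
  by apply: (XD); [exact: XM|apply: (XD); exact: XM].
by exists (MkSpec Xp).
Qed.

Section Decomposition.
Variable D : decomposition A.

Lemma dproj_inj a b : (forall i, dproj D i a = dproj D i b) -> a = b.
Proof. by move=> ab; apply: (bij_inj (dproj_bij D)); exact: functional_extensionality_dep. Qed.

Lemma dproj_surj (F : forall i, dfactor D i) : exists a, forall i, dproj D i a = F i.
Proof.
have [g _ gK] := dproj_bij D; exists (g F) => i.
exact: (congr1 (fun G : forall i, dfactor D i => G i) (gK F)).
Qed.

Lemma dproj_surj1 i (b : dfactor D i) : exists a, dproj D i a = b.
Proof.
(* The tuple with [b] in slot [i] and 0 elsewhere; the types of the slots differ, hence the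
   transport along i = j. *)
have [a aP] := dproj_surj (fun j => match @eqP _ i j with
  ReflectT ij => ecast j (dfactor D j) ij b | _ => 0 end).
exists a; rewrite aP; case: eqP => // ii.
by rewrite (eq_irrelevance ii erefl).
Qed.

Lemma decomposition_idem : exists E : 'I_(dsize D) -> A,
  [/\ forall i, E i * E i = E i, \sum_i E i = 1 &
    forall i a b, dproj D i a = dproj D i b -> E i * a = E i * b].
Proof.
have /choice[E EP] : forall i, exists a, forall j, dproj D j a = (i == j)%:R.
  by move=> i; exact: (dproj_surj (fun j => (i == j)%:R)).
exists E; split.
- by move=> i; apply: dproj_inj => j; rewrite rmorphM EP; case: eqP; rewrite ?mulr1 ?mulr0.
- apply: dproj_inj => j; rewrite rmorph_sum rmorph1 (bigD1 j)//= EP eqxx.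
  by rewrite big1 ?addr0// => i ij; rewrite EP (negbTE ij).
- move=> i a b ab; apply: dproj_inj => j; rewrite !rmorphM EP.
  by case: eqP => [<-|_]; rewrite ?mul0r// ab.
Qed.

(** A prime avoiding the idempotent of a factor contains the kernel of the projection, so its image
    there is prime. This ties values on Spec(A_i) to points of Spec(A). *)
Lemma comap_dproj i (E : A) (p : Spec A) :
  (forall a b, dproj D i a = dproj D i b -> E * a = E * b) -> ~ spec_ideal p E ->
  exists q : Spec (dfactor D i), comap (dproj D i) q = p.
Proof.
move=> EP pE; have [p0 pD pM p1 pP] := spec_idealP p.
have pE' a : spec_ideal p (E * a) -> spec_ideal p a by move=> /pP[].
have pdiff a b : dproj D i a = dproj D i b -> spec_ideal p a -> spec_ideal p b.
  by move=> ab pa; apply: pE'; rewrite -(EP _ _ ab); exact: pM.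
pose q := [set b | exists2 a, spec_ideal p a & dproj D i a = b].
have qP : prime_ideal q.
  split.
  - by exists 0; rewrite ?rmorph0.
  - by move=> _ _ [a pa <-] [b pb <-]; exists (a + b); [exact: pD|exact: rmorphD].
  - move=> u _ [b pb <-]; have [a <-] := dproj_surj1 u.
    by exists (a * b); [exact: pM|exact: rmorphM].
  - by move=> [a pa a1]; apply/p1/(pdiff a); rewrite ?rmorph1.
  - move=> u v [a pa auv]; have [u' u'E] := dproj_surj1 u; have [v' v'E] := dproj_surj1 v.
    have /pP[pu|pv] : spec_ideal p (u' * v') by apply: (pdiff a); rewrite ?rmorphM ?u'E ?v'E.
    + by left; exists u'.
    + by right; exists v'.
exists (MkSpec qP); apply: Spec_eq; apply/seteqP; split=> a /=.
  by move=> [b pb /pdiff]; apply.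
by move=> pa; exists a.
Qed.

End Decomposition.

End Localization.

Section Invariants.
Variable A : comPzRingType.

Lemma spec_idealM (p : Spec A) a b : spec_ideal p b -> spec_ideal p (a * b).
Proof. by case: (spec_idealP p) => _ _ + _ _; exact. Qed.

Lemma is_nu_local m (f : ilaurent A m) v : is_nu f v -> local_pred (fun e =>
  exists l : mindex m, [/\ forall k, lexlt k l -> nilpotent (e * icoef f k),
    exists b, e * icoef f l * b = e &
    forall p : Spec A, ~ spec_ideal p e -> forall j, v j 0 p = l j]).
Proof.
move=> [D [l [low unit vl]]]; split=> [e e' [k [kl [b eb] kp]]|].
  exists k; split=> [k' k'k|| p pe].
  - by rewrite -mulrA mulrC; exact/nilpotentM/kl.
  - by exists b; rewrite -!mulrA mulrA -!mulrA (mulrA e) eb.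
  - by apply: kp => pe'; apply/pe/spec_idealM.
have [E [EE E1 Ed]] := decomposition_idem D.
exists 'I_(dsize D), E; split=> // i; exists (l i); split=> [k kl||p pE j].
- have [s] := low _ _ kl; rewrite -rmorphXn /= -(rmorph0 (dproj D i)) => /Ed.
  (* [E i ^+ 0] is 1 and not [E i], so the exponent is raised by one. *)
  rewrite mulr0 => Es; exists s.+1; rewrite exprMn exprSr (exprSr (icoef f k)).
  have Ex t : E i ^+ t.+1 = E i by elim: t => // t IH; rewrite exprS IH.
  by rewrite -exprSr Ex mulrA Es mul0r.
- have [b'] := unit i; have [b <-] := dproj_surj1 b'.
  rewrite -rmorphM -(rmorph1 (dproj D i)) => /Ed; rewrite mulr1 => Eb.
  by exists b; rewrite -mulrA.
- have [q <-] := comap_dproj (Ed i) pE.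
  exact: (congr1 (fun k : mindex m => k j) (vl i q)).
Qed.

(** A nonzero value is not the default of [xget], so a decomposition defining it exists. *)
Lemma Zbar_to_ring_local (c : Zbar A) : Zbar_to_ring c <> 0 -> local_pred (fun e =>
  exists z : int, e * Zbar_to_ring c = e * z%:~R /\
    forall p : Spec A, ~ spec_ideal p e -> c p = z).
Proof.
rewrite /Zbar_to_ring; case: xgetP => [a -> [D [z [cz az]]] _|_ //].
split=> [e e' [t [et pt]]|].
  exists t; split=> [|p pe]; first by rewrite -!mulrA et.
  by apply: pt => pe'; apply/pe/spec_idealM.
have [E [EE E1 Ed]] := decomposition_idem D.
exists 'I_(dsize D), E; split=> // i; exists (z i); split=> [|p pE].
  by apply: Ed; rewrite rmorph_int.
by have [q <-] := comap_dproj (Ed i) pE; exact: cz.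
Qed.

Lemma Zbar_prodE (I : Type) (r : seq I) (F : I -> Zbar A) (p : Spec A) :
  (\prod_(i <- r) F i) p = \prod_(i <- r) F i p.
Proof. exact: (big_morph (fun c : Zbar A => c p)). Qed.

Lemma lead_val_pivot m (v : 'cV[Zbar A]_m) (p : Spec A) : lead_val v p <> 0 ->
  exists k : 'I_m, [/\ lead_val v p = v k 0 p, 0 < v k 0 p &
    forall j : 'I_m, (k < j)%N -> v j 0 p = 0].
Proof.
rewrite /lead_val; case: pickP => [k /andP[vk /forallP v0] _|//].
by exists k; split=> // j kj; move/implyP: (v0 j) => /(_ kj)/eqP.
Qed.

(* The default value of [nu] on an element with no valuation is 0. *)
Lemma lead_val0 m (p : Spec A) : lead_val (0 : 'cV[Zbar A]_m) p = 0.
Proof. by rewrite /lead_val; case: pickP => // k; rewrite mxE ltxx. Qed.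

Lemma Zbar_to_ring0 (c : Zbar A) : (forall p, c p = 0) -> Zbar_to_ring c = 0.
Proof.
move=> c0; have [//|/eqP/Zbar_to_ring_local cl] := eqVneq (Zbar_to_ring c) 0.
(* [ilaurent A 0] is A, so the covering argument applies to elements of A. *)
have := @local_cover A 0 unit [:: tt] (fun=> _) (Zbar_to_ring c) (fun=> cl).
apply=> e ee /(_ tt (mem_head _ _))[z [ez pz]].
have [e0|e0] := pselect (e = 0); first by rewrite /= e0 mul0r.
have [p pe] := prime_avoiding ee e0.
by rewrite /= ez -(pz p pe) c0 mulr0.
Qed.

End Invariants.

(** * Stability of the kernel by induction on the order *)

Section Main.
Variables (A : comPzRingType) (n m : nat) (phi : {rmorphism ilaurent A n -> ilaurent A m}).
Hypothesis phi_mono0 : forall a, phi (mono a 0) = mono a 0.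
Hypothesis phi_ucont : ucont phi.
Hypothesis d_reg : forall b : A, Zbar_to_ring (dinvariant phi) * b = 0 -> b = 0.
Hypothesis A_nontrivial : (1 : A) <> 0.

Let d := Zbar_to_ring (dinvariant phi).

Let d_neq0 : d <> 0.
Proof. by move=> d0; apply/A_nontrivial/d_reg; rewrite -/d d0 mul0r. Qed.

Let dE p : dinvariant phi p = \prod_(i < n) lead_val (col i (Upsilon phi)) p.
Proof. exact: Zbar_prodE. Qed.

Let colE i j p : col i (Upsilon phi) j 0 p = nu (phi (mono 1 (mbase i))) j 0 p.
Proof. by rewrite !mxE tvar_mono. Qed.

(** Otherwise [nu] takes its default 0, the whole column vanishes and d is 0, which regularity
    excludes in a nonzero ring. *)
Let nuP i : is_nu (phi (mono 1 (mbase i))) (nu (phi (mono 1 (mbase i)))).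
Proof.
have [//|nu0] := pselect (is_nu (phi (mono 1 (mbase i))) (nu (phi (mono 1 (mbase i))))).
case: d_neq0; apply: Zbar_to_ring0 => p; rewrite dE (bigD1 i)//=.
suff -> : col i (Upsilon phi) = 0 by rewrite lead_val0 mul0r.
apply/matrixP => j k; rewrite !mxE tvar_mono; move: nu0; rewrite /nu.
by case: xgetP => [v -> //|_ _]; rewrite mxE.
Qed.

Lemma hasse_kernel r (i : 'I_n) f : phi f = 0 -> phi (hasse i r f) = 0.
Proof.
elim/ltn_ind: r i f => r IH i0 f f0.
have [->|r0] := posnP r; first by rewrite (HS0 (HS_hasse i0)).
have flow (s : 'I_n -> nat) : (forall i, (s i < r)%N) -> phi (dop (bprod s) f) = 0.
  move=> sr; apply: (stable_prod _ (c := fun i k => binz (k i) (s i))) => // i g g0.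
  exact: IH.
(* One idempotent must serve all data at once: [Some i] for the valuation of the [i]-th image,
   [None] for d. *)
pose Q (o : option 'I_n) (e : A) := if o is Some i then
    exists l : mindex m, [/\ forall k, lexlt k l -> nilpotent (e * icoef (phi (mono 1 (mbase i))) k),
      exists b, e * icoef (phi (mono 1 (mbase i))) l * b = e &
      forall p : Spec A, ~ spec_ideal p e -> forall j, nu (phi (mono 1 (mbase i))) j 0 p = l j]
  else exists z : int, e * d = e * z%:~R /\
    forall p : Spec A, ~ spec_ideal p e -> dinvariant phi p = z.
apply: (local_cover (r := enum {: option 'I_n}) (Q := Q)).
  by case=> [i|]; [exact: is_nu_local (nuP i)|exact: Zbar_to_ring_local].
move=> e ee eQ; have [e0|e0] := pselect (e = 0); first by rewrite e0 mono0 mul0r.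
have [z [ez pz]] := eQ None (mem_enum _ _).
have /choice[l lP] : forall i, exists l : mindex m,
    [/\ forall k, lexlt k l -> nilpotent (e * icoef (phi (mono 1 (mbase i))) k),
      exists b, e * icoef (phi (mono 1 (mbase i))) l * b = e &
      forall p : Spec A, ~ spec_ideal p e -> forall j, nu (phi (mono 1 (mbase i))) j 0 p = l j].
  by move=> i; exact: eQ (Some i) (mem_enum _ _).
have [p pe] := prime_avoiding ee e0.
have zE : z = \prod_(i < n) lead_val (col i (Upsilon phi)) p by rewrite -(pz p pe) dE.
have z0 : z <> 0.
  by move=> z0; apply/e0/d_reg; rewrite -/d mulrC ez z0 mulr0.
(* As [z] is a nonzero product of leading entries, none of them is the default 0, and every column
   has a pivot. *)
have /choice[piv pivP] : forall i, exists k : 'I_m,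
    [/\ lead_val (col i (Upsilon phi)) p = l i k, 0 < l i k &
    forall j : 'I_m, (k < j)%N -> l i j = 0].
  move=> i; have vl j : col i (Upsilon phi) j 0 p = l i j.
    by rewrite colE; case: (lP i) => _ _; exact.
  have lead0 : lead_val (col i (Upsilon phi)) p <> 0.
    by move=> E; apply: z0; rewrite zE (bigD1 i)//= E mul0r.
  have [k [kE k0 kj]] := lead_val_pivot lead0.
  by exists k; rewrite -vl; split=> // j /kj; rewrite vl.
have low i := let: And3 h _ _ := lP i in h.
have unit i := let: And3 _ h _ := lP i in h.
have l0 i := let: And3 _ _ h := pivP i in h.
have lpos i := let: And3 _ h _ := pivP i in h.
apply: (component_step phi_mono0 phi_ucont ee low unit (p := piv) (d := d)) => //.
  exact: (echelon phi_ucont ee low unit e0 lpos l0).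
by rewrite ez zE; congr (_ * _%:~R); apply: eq_bigr => i _; case: (pivP i).
Qed.

End Main.

Lemma continuous_ucont (A : comPzRingType) (n m : nat)
  (phi : {rmorphism ilaurent A n -> ilaurent A m}) : continuous phi -> ucont phi.
Proof.
move=> phi_cont lam.
have [|mu _ muP] := phi_cont 0 [set g | Unbhs A lam (g - phi 0)]; first by exists lam.
exists mu => f fU; have /= := muP f; rewrite rmorph0 !subr0.
by move=> /(_ ((UnbhsP _ _).2 fU)) /UnbhsP.
Qed.

Theorem corollary5p6 (A : comPzRingType) (n m : nat) (n_ge1 : (1 <= n)%N)
    (m_ge1 : (1 <= m)%N) (phi : {rmorphism ilaurent A n -> ilaurent A m})
    (phi_alg : forall a : A, phi (ilaurentC n a) = ilaurentC m a)
    (phi_cont : continuous phi)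
    (d_nzd : forall b : A, Zbar_to_ring (dinvariant phi) * b = 0 -> b = 0) :
  injective phi.
Proof.
have phi_mono0 a : phi (mono a 0) = mono a 0 by rewrite -!ilaurentC_mono.
have phi_ucont := continuous_ucont phi_cont.
move=> f g fg; apply/eqP; rewrite -subr_eq0; apply/eqP.
(* Over the zero ring all series are 0; over any other ring regularity makes d nonzero, which rules
   out the default values. *)
have [A0|A1] := pselect ((1 : A) = 0).
  by apply: icoef_inj => l; rewrite -[LHS]mul1r -[RHS]mul1r A0 !mul0r.
apply: (stable_kernel phi_mono0 phi_ucont); last by rewrite rmorphB fg subrr.
move=> i s h h0; exact: (hasse_kernel phi_mono0 phi_ucont d_nzd A1).
Qed.
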